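(* Fix an integer $r\ge 4$. There is $n_0$ such that for all $n\ge n_0$ the following holds. If $H$ is an $n$-vertex intersecting $r$-graph with $\tau(H)\ge 2$ and $|H|>hm''(n,r)$, then $H\subseteq HM(n,r,t)$ for some $t\in\{1,\ldots,r-1,n-r\}$, or $r=4$ and $H\subseteq HM(n,4,0)$. The bound on $|H|$ is sharp, as witnessed by $HM''(n,r)$.
   Context: An $r$-graph is a family of $r$-element subsets (edges) of a finite vertex set; it is $n$-vertex if the vertex set has $n$ elements. $H$ is intersecting if every two edges intersect. $\tau(H)$ is the minimum size of a set of vertices meeting every edge. ''$H\subseteq K$'' for a named construction $K$ on $n$ vertices means that the special vertices of $K$ can be chosen among the vertices of $H$ so that every edge of $H$ is an edge of $K$. Constructions (on vertex set of size $n$): $HM(n,r,t)$, for $1\le t\le r-1$ or $t=n-r$: special distinct vertices $x,x_1,\ldots,x_{r-1},y_1,\ldots,y_t$; edges are all $r$-sets $e$ with (1) $\{x,x_i\}\subseteq e$ for some $i\in[r-1]$, or (2) $e=\{x_1,\ldots,x_{r-1},y_j\}$ for some $1\le j\le t$, and (3) if $1\le t\le r-1$, also all $r$-sets $e$ with $\{x,y_1,\ldots,y_t\}\subseteq e$. $HM(n,r,0)$: special vertices $x,x_1,x_2$; edges are all $r$-sets containing at least two of these three vertices. $HM''(n,r)$: special distinct vertices $x,x_1,\ldots,x_{r-2},y_1,y_1',y_2,y_2'$; edges are all $r$-sets $e$ such that (1) $\{x,x_i\}\subseteq e$ for some $i\in[r-2]$, or (2) $e$ contains one of $\{x,y_1,y_2\},\{x,y_1,y_2'\},\{x,y_1',y_2\},\{x,y_1',y_2'\}$,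 or (3) $e=\{x_1,\ldots,x_{r-2},y_1,y_1'\}$ or $e=\{x_1,\ldots,x_{r-2},y_2,y_2'\}$. Let $hm''(n,r)=|HM''(n,r)|$. *)

(* Defs.v *)
From mathcomp Require Import all_boot.

Set Implicit Arguments.
Unset Strict Implicit.
Unset Printing Implicit Defensive.

Section Hypergraphs.

Variables (T : finType) (r : nat).
Implicit Types (H K : {set {set T}}) (S e f : {set T}).

Definition r_graph H : Prop := forall e, e \in H -> #|e| = r.

Definition intersecting H : Prop :=
  forall e f, e \in H -> f \in H -> e :&: f != set0.

Definition meets_all H S : bool := [forall e in H, S :&: e != set0].

(* The default [setT] meets every edge as soon as no edge is empty, which is
   the case for r-graphs with r > 0; otherwise the value is meaningless. *)
Definition tau H : nat := #|[arg min_(S < setT | meets_all H S) #|S| ]|.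

(* HM(n,r,t), with n = #|T| and chosen special vertices
   x, x_1, ..., x_{r-1} (xs) and y_1, ..., y_t (ys). *)
Definition HM t (x : T) (xs : (r.-1).-tuple T) (ys : t.-tuple T) :
    {set {set T}} :=
  [set e : {set T} | (#|e| == r) &&
    [|| [exists i, [set x; tnth xs i] \subset e],
        [exists j, e == tnth ys j |: [set:: xs]]
      | (1 <= t <= r.-1) && (x |: [set:: ys] \subset e)]].

Definition HM0 (x x1 x2 : T) : {set {set T}} :=
  [set e : {set T} | (#|e| == r) && (2 <= #|e :&: [set x; x1; x2]|)].

(* HM''(n,r), with n = #|T| and chosen special vertices
   x, x_1, ..., x_{r-2} (xs), y1, y1', y2, y2'. *)
Definition HM'' (x : T) (xs : (r.-2).-tuple T) (y1 y1' y2 y2' : T) :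
    {set {set T}} :=
  [set e : {set T} | (#|e| == r) &&
    [|| [exists i, [set x; tnth xs i] \subset e],
        [|| [set x; y1; y2] \subset e, [set x; y1; y2'] \subset e,
            [set x; y1'; y2] \subset e | [set x; y1'; y2'] \subset e],
        e == [set:: xs] :|: [set y1; y1']
      | e == [set:: xs] :|: [set y2; y2']]].

Definition sub_HM t H : Prop :=
  exists (x : T) (xs : (r.-1).-tuple T) (ys : t.-tuple T),
    uniq (x :: xs ++ ys) /\ H \subset HM x xs ys.

Definition sub_HM0 H : Prop :=
  exists x x1 x2 : T, uniq [:: x; x1; x2] /\ H \subset HM0 x x1 x2.

Definition is_HM'' K : bool :=
  [exists x : T, [exists xs : (r.-2).-tuple T,
   [exists y1 : T, [exists y1' : T, [exists y2 : T, [exists y2' : T,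
     uniq (x :: xs ++ [:: y1; y1'; y2; y2'])
     && (K == HM'' x xs y1 y1' y2 y2')]]]]]].

End Hypergraphs.

(* All copies of HM''(n,r) on n vertices are isomorphic, so the maximum is
   just their common number of edges. *)
Definition hm'' (n r : nat) : nat :=
  \max_(K : {set {set 'I_n}} | is_HM'' r K) #|K|.

(* H is contained in HM(n,r,t) for some t in {1, ..., r-1, n-r}, or r = 4 and
   H is contained in HM(n,4,0), where n = #|T|. *)
Definition sub_some_HM (T : finType) (r : nat) (H : {set {set T}}) : Prop :=
  (exists t : nat, ((1 <= t <= r.-1) || (t == #|T| - r)) /\ sub_HM r t H)
  \/ (r = 4 /\ sub_HM0 4 H).

(* Main.v *)
(* Enlarging H, we may assume that it is a maximal intersecting r-graph; then any
   two transversals with at most r vertices meet. So the 2-element transversals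
   either contain a triangle, whence H is inside HM(n,r,0), which for r > 4 is no
   larger than HM''(n,r), or they all contain one vertex x. Let L be the set of
   the leaves l such that {x,l} is a transversal; every edge avoiding x contains
   L, so |L| <= r, and |L| >= r - 1 puts H inside some HM(n,r,t). A branching
   argument shows that only O(n^(r-3)) edges contain no 2-element transversal, so
   |L| <= r - 3 makes H too small. If |L| = r - 2, the edges avoiding x are the
   union of L with the edges of a graph G, and the edges containing x and missing
   L are given by the (r-1)-element vertex covers of G. No single vertex covers
   G, so G has at most four 2-element covers. If G has four of them, it consists
   of two disjoint edges and H is inside HM''(n,r). If it has at most three, the
   number of edges of G is small enough for H to be smaller than HM''(n,r).

   For sharpness: the transversals of HM''(n,r) with at most two elements are
   the r - 2 pairs {x,x_i}, whereas HM(n,r,t) has the r - 1 pairs {x,x_i} and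
   HM(n,r,0) has a triangle. *)

Require Import Defs.
From mathcomp Require Import all_boot.
From mathcomp Require Import zify.

Set Implicit Arguments.
Unset Strict Implicit.
Unset Printing Implicit Defensive.

(** * Estimates on binomial coefficients *)

Lemma binSl_leq m j : j.*2 <= m.+1 -> 'C(m.+1, j) <= 2 * 'C(m, j).
Proof.
case: j => [|j]; first by rewrite !bin0.
move=> le_jm; rewrite binS mulSn mul1n leq_add2l.
rewrite -(leq_pmul2l (ltn0Sn j)) mul_bin_left leq_mul2r; apply/orP; right; lia.
Qed.

Lemma bin_addl_leq c m j : j.*2 <= m.+1 -> 'C(m + c, j) <= 2 ^ c * 'C(m, j).
Proof.
move=> le_jm; elim: c => [|c IHc]; first by rewrite addn0 mul1n.
rewrite addnS expnS -mulnA (leq_trans (binSl_leq _)) ?leq_mul2l ?IHc //; lia.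
Qed.

(** With [m = n - c], the left side is at most [A * 2 ^ c * 'C(m, k)], while the ratio of
    ['C(m, k.+1)] to ['C(m, k)] is [(m - k) / k.+1], which is unbounded. *)
Lemma bin_dominates A c k :
  exists N, forall n, N <= n -> A * 'C(n, k) <= 'C(n - c, k.+1).
Proof.
(* The terms ensure [c <= n], a ratio of at least [A * 2 ^ c], and the condition [k.*2 <= m.+1] of
   [bin_addl_leq]. *)
exists (c + k.+1 * (A * 2 ^ c) + k.+1.*2) => n le_Nn.
have le_cn : c <= n by apply: leq_trans le_Nn; rewrite -addnA leq_addr.
have [m def_n]: exists m, n = m + c by exists (n - c); rewrite subnK.
rewrite {le_cn}def_n in le_Nn *; rewrite addnK.
apply: leq_trans (_ : A * (2 ^ c * 'C(m, k)) <= _).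
  by rewrite leq_mul2l bin_addl_leq ?orbT //; lia.
rewrite -(leq_pmul2l (ltn0Sn k)) mul_bin_left !mulnA leq_mul2r.
by apply/orP; right; rewrite -mulnA; lia.
Qed.

(** Pascal's rule applied [c] times, each use losing at most ['C(n, k)]. *)
Lemma bin_subl_leq c n k : 'C(n, k.+1) <= 'C(n - c, k.+1) + c * 'C(n, k).
Proof.
elim: c => [|c IHc]; first by rewrite subn0 addn0.
rewrite mulSn addnCA (leq_trans IHc) // addnA leq_add2r.
rewrite subnS; case def_m: (n - c) => [|m] /=; first by rewrite leq_addl.
by rewrite binS addnC leq_add2r leq_bin2l //; lia.
Qed.

Lemma leq_bin2r n j k : j <= k -> k.*2 <= n.+1 -> 'C(n, j) <= 'C(n, k).
Proof.
elim: k => [|k IHk]; first by rewrite leqn0 => /eqP->.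
rewrite leq_eqVlt => /orP[/eqP-> //|]; rewrite ltnS => le_jk le_kn.
apply: leq_trans (IHk le_jk _) _; first lia.
rewrite -(leq_pmul2l (ltn0Sn k)) mul_bin_left leq_mul2r; apply/orP; right; lia.
Qed.

(** * Upper and lower bounds on the size of set families *)

Section Counting.

Variable T : finType.
Implicit Types (F D P : {set {set T}}) (A U S Z e d p : {set T}).

(** Deleting [S] is injective on [F]. The remainders are counted among all subsets of [T], which is
    precise enough for leading terms. *)
Lemma card_family_supersets F q S :
    (forall e, e \in F -> #|e| = q) -> (forall e, e \in F -> S \subset e) ->
  #|F| <= 'C(#|T|, q - #|S|).
Proof.
move=> Fq FS; rewrite -cardsT -cards_draws.
have injS : {in F &, injective (fun e => e :\: S)}.
  move=> e f Fe Ff /= eq_ef.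
  by rewrite -(setID e S) -(setID f S) eq_ef !(setIidPr _) ?FS.
rewrite -(card_in_imset injS); apply: subset_leq_card.
apply/subsetP=> _ /imsetP[e Fe ->]; rewrite inE subsetT /=.
by rewrite cardsD (setIidPr (FS e Fe)) Fq.
Qed.

Lemma leq_card_bigcup (I : finType) (A : {set I}) (F : {set {set T}})
    (G : I -> {set {set T}}) k :
    (forall e, e \in F -> exists2 i, i \in A & e \in G i) ->
    (forall i, i \in A -> #|G i| <= k) ->
  #|F| <= #|A| * k.
Proof.
move=> FG Gk; apply: leq_trans (_ : #|\bigcup_(i in A) G i| <= _).
  apply/subset_leq_card/subsetP=> e /FG[i Ai Gie].
  by apply/bigcupP; exists i.
rewrite -sum_nat_const; elim/big_rec2: _ => [|i a B Ai le_Ba].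
  by rewrite cards0.
by rewrite (leq_trans (leq_card_setU _ _)) ?leq_add ?Gk.
Qed.

Lemma card_family_cover F P q s :
    (forall e, e \in F -> #|e| = q) -> (forall p, p \in P -> #|p| = s) ->
    (forall e, e \in F -> exists2 p, p \in P & p \subset e) ->
  #|F| <= #|P| * 'C(#|T|, q - s).
Proof.
move=> Fq Ps FP.
apply: (leq_card_bigcup (A := P) (G := fun p => [set e in F | p \subset e])).
  by move=> e Fe; have [p Pp pe] := FP e Fe; exists p; rewrite // inE Fe.
move=> p Pp; rewrite -(Ps p Pp); apply: card_family_supersets.
  by move=> e; rewrite inE => /andP[/Fq].
by move=> e; rewrite inE => /andP[].
Qed.

(* Branching: a set that meets every member of [D] is guessed one element at a
   time, each guess being made in a member of [D] missed by the previous ones. *)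
Lemma card_family_branch D s j F q U :
    (forall d, d \in D -> #|d| <= s) ->
    (forall e, e \in F -> [/\ #|e| = q, U \subset e & meets_all D e]) ->
    (forall e U', e \in F -> U' \subset e -> #|U'| < #|U| + j ->
       ~~ meets_all D U') ->
  #|F| <= s ^ j * 'C(#|T|, q - (#|U| + j)).
Proof.
move=> Ds; elim: j F U => [|j IHj] F U Fprops Fsmall.
  rewrite mul1n addn0; apply: card_family_supersets => e /Fprops[] //.
have [-> | [e0 Fe0]] := set_0Vmem F; first by rewrite cards0.
have [_ Ue0 _] := Fprops _ Fe0.
(* As [U] lies in a member of [F] and is still small, it misses some [d] in [D]. Every member of [F]
   meets [d], so it contains [v |: U] for one of at most [s] elements [v]. *)
have := Fsmall e0 U Fe0 Ue0; rewrite addnS ltnS leq_addr => /(_ isT).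
case/forall_inPn=> d Dd; rewrite negbK => /eqP Ud0.
rewrite expnS -mulnA; apply: leq_trans (leq_mul (Ds d Dd) (leqnn _)).
apply: (@leq_card_bigcup _ _ _ (fun v => [set e in F | v \in e])).
  move=> e Fe; have [_ _ /forall_inP/(_ d Dd)/set0Pn[v]] := Fprops e Fe.
  by rewrite inE => /andP[ev dv]; exists v; rewrite // inE Fe.
move=> v dv; have UvS : #|v |: U| = #|U|.+1.
  rewrite cardsU1; suff -> : v \notin U by [].
  by apply/negP=> Uv; have := in_set0 v; rewrite -Ud0 inE Uv dv.
rewrite -addSn -UvS; apply: IHj.
  move=> e; rewrite inE => /andP[/Fprops[eq_eq Ue De] ev].
  by split; rewrite // subUset sub1set ev.
move=> e U'; rewrite inE UvS addSn -addnS => /andP[Fe _]; exact: Fsmall.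
Qed.

(** The pair [(p, A)] is recovered from [p :|: A] as its parts inside and outside [Z], so distinct
    pairs give distinct members of [F]. *)
Lemma card_family_traces F P Z k :
    (forall p, p \in P -> p \subset Z) ->
    (forall p A, p \in P -> A \subset ~: Z -> #|A| = k -> p :|: A \in F) ->
  #|P| * 'C(#|T| - #|Z|, k) <= #|F|.
Proof.
move=> PZ PF; have -> : #|T| - #|Z| = #|~: Z| by rewrite -(cardsC Z) addKn.
pose D := [set A : {set T} | (A \subset ~: Z) && (#|A| == k)].
have /= <- := cards_draws (~: Z) k; rewrite -/D -cardsX.
have trace (p A : {set T}) :
    p \subset Z -> A \subset ~: Z -> (p :|: A) :&: Z = p /\ (p :|: A) :\: Z = A.
  move=> pZ AZ; split; apply/setP=> z; rewrite !inE.
    have := subsetP pZ z; have := subsetP AZ z; rewrite inE.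
    by case: (z \in p); case: (z \in A); case: (z \in Z) => //= a b;
       first [have:= a isT | have:= b isT].
  have := subsetP pZ z; have := subsetP AZ z; rewrite inE.
  by case: (z \in p); case: (z \in A); case: (z \in Z) => //= a b;
     first [have:= a isT | have:= b isT].
have inj : {in setX P D &, injective (fun u => u.1 :|: u.2)}.
  move=> [p A] [p' A']; rewrite !inE /=.
  move=> /andP[/PZ pZ /andP[AZ _]] /andP[/PZ p'Z /andP[A'Z _]] /= eq_u.
  have [e1 e2] := trace _ _ pZ AZ; have [e3 e4] := trace _ _ p'Z A'Z.
  by congr (_, _); [rewrite -e1 eq_u | rewrite -e2 eq_u].
rewrite -(card_in_imset inj); apply/subset_leq_card/subsetP=> e /imsetP[[p A]].
by rewrite !inE /= => /andP[Pp /andP[AZ /eqP Ak]] ->; apply: PF.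
Qed.

End Counting.

(** * Transversals and maximal intersecting families *)

Section Transversals.

Variable T : finType.
Implicit Types (H K : {set {set T}}) (S P Q X e f : {set T}).

Lemma meets_allP H S :
  reflect (forall e, e \in H -> exists2 v, v \in S & v \in e) (meets_all H S).
Proof.
apply: (iffP forall_inP) => HS e He; have := HS e He.
  by case/set0Pn=> v; rewrite inE => /andP[]; exists v.
by case=> v Sv ev; apply/set0Pn; exists v; rewrite inE Sv.
Qed.

Lemma not_meets_allP H S :
  reflect (exists2 e, e \in H & forall v, v \in S -> v \notin e)
          (~~ meets_all H S).
Proof.
apply: (iffP forall_inPn) => [[e He /negPn/eqP Se0] | [e He Se]]; exists e => //.
  move=> v Sv; apply/negP=> ev.
  by have := in_set0 v; rewrite -Se0 inE Sv ev.
by apply/negP=> /set0Pn[v]; rewrite inE => /andP[/Se/negP].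
Qed.

Lemma meets_allS H S S' : S \subset S' -> meets_all H S -> meets_all H S'.
Proof.
move=> sSS' /meets_allP HS; apply/meets_allP=> e /HS[v Sv ev].
by exists v; rewrite ?(subsetP sSS').
Qed.

Lemma meets_all_setT r H : 0 < r -> r_graph r H -> meets_all H setT.
Proof.
move=> r_gt0 Hr; apply/meets_allP=> e /Hr er.
by have /card_gt0P[v ev] : 0 < #|e| by [rewrite er]; exists v.
Qed.

(** The hypothesis makes the default value of the [arg min] in [tau] an admissible set, so that the
    minimum is genuine. *)
Lemma tau_gtP H k :
    meets_all H setT ->
  (k < tau H) <-> (forall S, meets_all H S -> k < #|S|).
Proof.
move=> HT; rewrite /tau; case: arg_minnP => // S HS minS.
by split=> [lt_kS S' /minS | /(_ S HS)//]; apply: leq_trans.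
Qed.

Lemma exists_subset_card X k :
  k <= #|X| -> exists2 S : {set T}, S \subset X & #|S| = k.
Proof.
move=> le_kX; have := cards_draws X k.
have: 0 < 'C(#|X|, k) by rewrite bin_gt0.
move=> C_gt0 defC; move: C_gt0; rewrite -defC => /card_gt0P[S].
by rewrite inE => /andP[SX /eqP]; exists S.
Qed.

Lemma exists_superset_avoiding P Q q :
    [disjoint P & Q] -> #|P| <= q -> q + #|Q| <= #|T| ->
  exists e, [/\ P \subset e, #|e| = q & [disjoint e & Q]].
Proof.
move=> dPQ le_Pq le_qT.
have cPQ : #|P :|: Q| = #|P| + #|Q|.
  by rewrite cardsU disjoint_setI0 // cards0 subn0.
have [|S sS cS] := @exists_subset_card (~: (P :|: Q)) (q - #|P|).
  have := cardsC (P :|: Q); rewrite cPQ; lia.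
have dSP : [disjoint S & P :|: Q] by rewrite disjoints_subset.
exists (P :|: S); split; first exact: subsetUl.
  rewrite cardsU disjoint_setI0 ?cards0 ?subn0 ?cS; first lia.
  by rewrite disjoint_sym (disjointWr (subsetUl P Q)).
rewrite -setI_eq0 setIUl setU_eq0 !setI_eq0 dPQ.
exact: disjointWr (subsetUr P Q) dSP.
Qed.

Definition maximal_intersecting r H :=
  [/\ r_graph r H, intersecting H &
      forall e, #|e| = r -> meets_all H e -> e \in H].

Lemma maximal_intersecting_exists r H :
    0 < r -> r_graph r H -> intersecting H ->
  exists2 K, maximal_intersecting r K & H \subset K.
Proof.
move=> r_gt0 Hr Hi.
pose good K := [forall e in K, #|e| == r]
   && [forall e in K, [forall f in K, e :&: f != set0]].
have goodP K : reflect (r_graph r K /\ intersecting K) (good K).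
  apply: (iffP andP) => -[Kr Ki]; split.
  - by move=> e Ke; apply/eqP; apply: (forall_inP Kr).
  - by move=> e f Ke Kf; have /forall_inP := forall_inP Ki e Ke; apply.
  - by apply/forall_inP=> e /Kr->.
  - by apply/forall_inP=> e Ke; apply/forall_inP=> f; apply: Ki.
have [K maxK sHK] : {K | maxset good K & H \subset K}.
  by apply: maxset_exists; apply/goodP.
exists K => //; have [/goodP[Kr Ki] Kmax] := maxsetP maxK.
(* Adding [e] keeps the family good, [e] meeting itself because [r] is positive; maximality then
   gives [e |: K = K]. *)
split=> // e er /forall_inP Ke; rewrite -(Kmax (e |: K)) ?setU11 ?subsetUr //.
have ee : e :&: e != set0 by rewrite setIid -card_gt0 er.
apply/goodP; split=> [f | f g]; rewrite !inE; first by case/predU1P=> [->|/Kr].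
move=> /predU1P[->|Kf] /predU1P[->|Kg] //; first exact: Ke.
- by rewrite setIC Ke.
- exact: Ki.
Qed.

(** Otherwise [P] extends to an [r]-set disjoint from [Q]. Containing a transversal, that set is an
    edge by maximality, yet [Q] misses it. *)
Lemma transversals_meet r H P Q :
    maximal_intersecting r H -> #|P| <= r -> r + #|Q| <= #|T| ->
    meets_all H P -> meets_all H Q ->
  ~~ [disjoint P & Q].
Proof.
move=> [_ _ Hmax] le_Pr le_rT HP /forall_inP HQ; apply/negP=> dPQ.
have [e [Pe er dQ]] := exists_superset_avoiding dPQ le_Pr le_rT.
have /HQ := Hmax e er (meets_allS Pe HP).
by rewrite setI_eq0 disjoint_sym dQ.
Qed.

Lemma set_tuple_exists X k :
  #|X| = k -> exists2 xs : k.-tuple T, uniq xs & [set:: xs] = X.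
Proof.
move=> <-; have sz : size (enum X) == #|X| by rewrite -cardE.
by exists (Tuple sz); [apply: enum_uniq | apply: set_enum].
Qed.

Lemma card_set_uniq (s : seq T) : uniq s -> #|[set:: s]| = size s.
Proof. by move=> s_uniq; rewrite cardsE; apply/card_uniqP. Qed.

End Transversals.

(** * The constructions described by sets instead of tuples *)

Section Constructions.

Variables (r : nat) (T : finType).
Implicit Types (H K : {set {set T}}) (L X Y e f : {set T}) (x y : T).

(** The structural argument yields special vertices as sets; any enumeration of [X] and [Y] serves
    as the tuples of [HM]. *)
Lemma sub_HM_of_sets t H x X Y :
    #|X| = r.-1 -> #|Y| = t -> x \notin X -> x \notin Y -> [disjoint X & Y] ->
    r_graph r H ->
    (forall e, e \in H ->
       [\/ x \in e /\ ~~ [disjoint e & X], exists2 y, y \in Y & e = y |: X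
         | 1 <= t <= r.-1 /\ x |: Y \subset e]) ->
  sub_HM r t H.
Proof.
move=> /set_tuple_exists[xs Uxs <-] /set_tuple_exists[ys Uys <-] xX xY dXY Hr H'.
exists x, xs, ys; split.
  rewrite cons_uniq cat_uniq mem_cat Uxs Uys negb_or andbT /=.
  move: xX xY; rewrite !inE => -> -> /=; apply/hasPn=> z zY /=; apply/negP=> zX.
  by have /pred0P/(_ z) := dXY; rewrite /= !inE zX zY.
apply/subsetP=> e He; rewrite inE Hr ?eqxx //=.
case: (H' e He) => [[xe ndX] | [y Yy ->] | [tr xYe]].
- have [v] := pred0Pn ndX => /= /andP[ev]; rewrite inE => /tnthP[i def_v].
  by apply/orP; left; apply/existsP; exists i; rewrite subUset !sub1set xe -def_v.
- move: Yy; rewrite inE => /tnthP[j def_y].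
  by apply/orP; right; apply/orP; left; apply/existsP; exists j; rewrite -def_y.
by rewrite tr xYe !orbT.
Qed.

(* HM''(n,r) with the vertices x_1, ..., x_{r-2} gathered in a set. *)
Definition HM''_set x L y1 y1' y2 y2' : {set {set T}} :=
  [set e : {set T} | (#|e| == r) &&
    [|| (x \in e) && ~~ [disjoint e & L],
        [&& x \in e, (y1 \in e) || (y1' \in e) & (y2 \in e) || (y2' \in e)],
        e == L :|: [set y1; y1'] | e == L :|: [set y2; y2']]].

Lemma HM''E x (xs : (r.-2).-tuple T) y1 y1' y2 y2' :
  HM'' x xs y1 y1' y2 y2' = HM''_set x [set:: xs] y1 y1' y2 y2'.
Proof.
apply/setP=> e; rewrite !inE; case: (#|e| == r) => //=.
congr [|| _, _ | _].
  apply/existsP/andP => [[i] | [xe /pred0Pn[v /= /andP[ev]]]].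
    rewrite subUset !sub1set => /andP[xe ei]; split=> //.
    by apply/pred0Pn; exists (tnth xs i); rewrite /= ei inE mem_tnth.
  by rewrite inE => /tnthP[i def_v]; exists i; rewrite subUset !sub1set xe -def_v.
rewrite !subUset !sub1set.
by case: (x \in e); case: (y1 \in e); case: (y1' \in e); case: (y2 \in e);
   case: (y2' \in e).
Qed.

Definition HM''_vertices x L y1 y1' y2 y2' :=
  [/\ #|L| = r.-2, uniq [:: x; y1; y1'; y2; y2']
    & {in [:: x; y1; y1'; y2; y2'], forall z, z \notin L}].

Lemma is_HM''P K :
  is_HM'' r K <-> exists x L y1 y1' y2 y2',
    HM''_vertices x L y1 y1' y2 y2' /\ K = HM''_set x L y1 y1' y2 y2'.
Proof.
split=> [/existsP[x /existsP[xs /existsP[y1 /existsP[y1' /existsP[y2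
  /existsP[y2' /andP[]]]]]]]|].
  rewrite HM''E cons_uniq cat_uniq mem_cat negb_or.
  move=> /andP[/andP[xx xy] /and3P[Uxs /hasPn xsy Uy]] /eqP ->.
  exists x, [set:: xs], y1, y1', y2, y2'; split=> //; split.
  - by rewrite card_set_uniq // size_tuple.
  - by rewrite cons_uniq xy.
  by move=> z /predU1P[->|/xsy zxs]; rewrite inE.
move=> [x [L [y1 [y1' [y2 [y2' [[cL Uy yL] ->]]]]]]].
have [xs Uxs defL] := set_tuple_exists cL.
apply/existsP; exists x; apply/existsP; exists xs; apply/existsP; exists y1.
apply/existsP; exists y1'; apply/existsP; exists y2; apply/existsP; exists y2'.
rewrite HM''E defL eqxx andbT cons_uniq cat_uniq mem_cat negb_or Uxs.
have xsL z : (z \in (xs : seq T)) = (z \in L) by rewrite -defL inE.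
move: Uy; rewrite cons_uniq => /andP[-> ->].
rewrite xsL yL ?mem_head ?andbT //; apply/hasPn=> z zy.
by rewrite /= xsL yL // in_cons zy orbT.
Qed.

Lemma HM''_vertices_exist x L :
    #|L| = r.-2 -> x \notin L -> #|L| + 5 <= #|T| ->
  exists y1 y1' y2 y2', HM''_vertices x L y1 y1' y2 y2'.
Proof.
move=> cL xL le_rT; have := cardsC (x |: L); rewrite cardsU1 xL => cU.
have sz : 4 <= size (enum (~: (x |: L))) by rewrite -cardE; lia.
have: uniq (enum (~: (x |: L))) by apply: enum_uniq.
have sub z : z \in enum (~: (x |: L)) -> (z != x) && (z \notin L).
  by rewrite mem_enum !inE negb_or.
case: (enum _) sz sub => [|y1 [|y1' [|y2 [|y2' s]]]] //= _ sub Us.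
have def4: [:: y1; y1'; y2; y2'] = take 4 [:: y1, y1', y2, y2' & s].
  by rewrite /= take0.
have Uy : uniq [:: y1; y1'; y2; y2'] by rewrite def4 take_uniq.
have yx : {in [:: y1; y1'; y2; y2'], forall z, (z != x) && (z \notin L)}.
  by move=> z; rewrite def4 => /mem_take/sub.
exists y1, y1', y2, y2'; split=> //.
  rewrite cons_uniq Uy andbT; apply/negP=> /yx; by rewrite eqxx.
by move=> z /predU1P[-> // | /yx/andP[]].
Qed.

End Constructions.

(** * Independence of |HM''(n,r)| from the copy *)

Section Isomorphism.

Variables (r : nat) (T1 T2 : finType).

(** Both sequences are completed to enumerations of their types, and entries at equal positions are
    matched. A nonempty [s2] provides the default value for [nth]. *)
Lemma exists_injection_map (s1 : seq T1) (s2 : seq T2) :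
    #|T1| = #|T2| -> uniq s1 -> uniq s2 -> size s1 = size s2 -> 0 < size s2 ->
  exists2 f : T1 -> T2, injective f & map f s1 = s2.
Proof.
move=> eqT U1 U2 eq_sz.
have compl (T : finType) (s : seq T) : uniq s ->
    exists s', [/\ uniq (s ++ s'), size (s ++ s') = #|T|
                 & forall z, z \in s ++ s'].
  move=> Us; pose s' := [seq z <- enum T | z \notin s].
  have Us' : uniq (s ++ s').
    rewrite cat_uniq Us filter_uniq ?enum_uniq // andbT.
    by apply/hasPn=> z; rewrite mem_filter => /andP[].
  have all_s z : z \in s ++ s'.
    by rewrite mem_cat mem_filter mem_enum andbT orbN.
  exists s'; split=> //; rewrite -(card_uniqP Us').
  by apply: eq_card => z; rewrite all_s.
have [s1' [U1' sz1 all1]] := compl _ _ U1.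
have [s2' [U2' sz2 all2]] := compl _ _ U2.
case def_s2: s2 => [//|z0 s] _; rewrite -def_s2.
pose f t := nth z0 (s2 ++ s2') (index t (s1 ++ s1')).
have lt_index t : index t (s1 ++ s1') < size (s2 ++ s2').
  by rewrite sz2 -eqT -sz1 index_mem.
exists f.
  move=> t t' /eqP; rewrite nth_uniq // => /eqP eq_index.
  by rewrite -(nth_index t (all1 t)) -[RHS](nth_index t (all1 t')) eq_index.
apply: (@eq_from_nth _ z0); rewrite size_map // => i lt_i1.
have [t0 _] : exists t : T1, true by case: (s1) lt_i1 => // t; exists t.
rewrite (nth_map t0) // /f index_cat mem_nth // index_uniq // nth_cat.
by rewrite -eq_sz lt_i1.
Qed.

Lemma imset_HM'' (f : T1 -> T2) x (L : {set T1}) y1 y1' y2 y2' (e : {set T1}) :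
    injective f ->
  (f @: e \in HM''_set r (f x) (f @: L) (f y1) (f y1') (f y2) (f y2'))
    = (e \in HM''_set r x L y1 y1' y2 y2').
Proof.
move=> f_inj; have imI := imset_inj f_inj.
rewrite !inE card_imset // !mem_imset //.
by rewrite -!setI_eq0 -imsetI ?imset_eq0; [rewrite -!imset_set1 -!imsetU !(inj_eq imI)
  | move=> ? ? _ _; apply: f_inj].
Qed.

(** A bijection of the vertices that carries special vertices to special vertices carries edges to
    edges. Used in both directions, the inequality gives equality. *)
Lemma leq_card_HM'' (K1 : {set {set T1}}) (K2 : {set {set T2}}) :
  #|T1| = #|T2| -> is_HM'' r K1 -> is_HM'' r K2 -> #|K1| <= #|K2|.
Proof.
move=> eqT /is_HM''P[x [L [y1 [y1' [y2 [y2' [[cL Uy yL] ->]]]]]]].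
move=> /is_HM''P[u [M [v1 [v1' [v2 [v2' [[cM Uv vM] ->]]]]]]].
have U (T : finType) (X : {set T}) s :
    uniq s -> {in s, forall z, z \notin X} -> uniq (s ++ enum X).
  move=> Us sX; rewrite cat_uniq Us enum_uniq andbT; apply/hasPn=> z.
  by rewrite mem_enum; apply: contraL => /sX.
have [||f f_inj] := exists_injection_map eqT (U _ _ _ Uy yL) (U _ _ _ Uv vM).
- by rewrite !size_cat -!cardE cL cM.
- by [].
rewrite map_cat /= => -[fx f1 f1' f2 f2' fL].
have {}fL : f @: L = M.
  apply/setP=> z; rewrite -(mem_enum M) -fL.
  by apply/imsetP/mapP => -[t tL ->]; exists t; rewrite // ?mem_enum // in tL *.
rewrite -(card_imset _ (imset_inj f_inj)); apply/subset_leq_card/subsetP.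
move=> _ /imsetP[e Ke ->].
by rewrite -fx -f1 -f1' -f2 -f2' -fL imset_HM''.
Qed.

End Isomorphism.

Lemma is_HM''_exists r (T : finType) :
  1 < r -> r + 3 <= #|T| -> exists K : {set {set T}}, is_HM'' r K.
Proof.
move=> r_gt1 le_rT.
have [|X _ cX] := @exists_subset_card T setT r.-1.
  by rewrite cardsT; lia.
have /card_gt0P[x Xx] : 0 < #|X| by lia.
have cL : #|X :\ x| = r.-2 by have := cardsD1 x X; rewrite Xx; lia.
have [||y1 [y1' [y2 [y2' V]]]] := @HM''_vertices_exist r T x (X :\ x) cL.
- by rewrite setD11.
- by lia.
by exists (HM''_set r x (X :\ x) y1 y1' y2 y2'); apply/is_HM''P; do 6!eexists; eauto.
Qed.

(** Transfers [hm''], a maximum over copies on ['I_n], to an arbitrary vertex type. One copy must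
    exist on ['I_n], since an empty maximum would be 0. *)
Lemma hm''_eq r (T : finType) (K : {set {set T}}) :
  1 < r -> r + 3 <= #|T| -> is_HM'' r K -> hm'' #|T| r = #|K|.
Proof.
move=> r_gt1 le_rT HK; have cI : #|'I_#|T| | = #|T| by rewrite card_ord.
apply/eqP; rewrite eqn_leq; apply/andP; split.
  by apply/bigmax_leqP=> K' HK'; apply: leq_card_HM'' HK.
have [|K' HK'] := @is_HM''_exists r 'I_#|T| r_gt1; first by rewrite cI.
apply: leq_trans (leq_card_HM'' (esym cI) HK HK') _.
by rewrite /hm''; apply: leq_bigmax_cond.
Qed.

(** * HM''(n,r) is intersecting and lies in none of the other constructions *)

Section Sharpness.

Variables (r : nat) (T : finType) (x : T) (L : {set T}) (y1 y1' y2 y2' : T).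
Hypotheses (r_ge4 : 4 <= r) (V : HM''_vertices r x L y1 y1' y2 y2').
Let K := HM''_set r x L y1 y1' y2 y2'.

Let cardL : #|L| = r.-2. Proof. by case: V. Qed.
Let xL : x \notin L. Proof. by case: V => _ _; apply; rewrite mem_head. Qed.

Let yL z : z \in [:: y1; y1'; y2; y2'] -> (z == x) = false /\ z \notin L.
Proof.
case: V => _ /= /andP[xy _] yL yz; split; last by rewrite yL // in_cons yz orbT.
by apply/negP=> /eqP eq_zx; rewrite eq_zx (negPf xy) in yz.
Qed.

Lemma HM''_fixed_edges : L :|: [set y1; y1'] \in K /\ L :|: [set y2; y2'] \in K.
Proof.
have card_edge y y' : y != y' -> y \notin L -> y' \notin L ->
    #|L :|: [set y; y']| = r.
  move=> ney nyL ny'L; rewrite cardsU cards2 ney cardL.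
  have -> : L :&: [set y; y'] = set0.
    apply/eqP; rewrite setI_eq0 disjoint_sym disjoints_subset subUset !sub1set.
    by rewrite !inE nyL ny'L.
  by rewrite cards0; lia.
have [n1 n2] : y1 != y1' /\ y2 != y2'.
  by case: V => _ /=; rewrite !inE !negb_or => /and5P[_ /and3P[-> _ _] _ -> _].
have nyL z : z \in [:: y1; y1'; y2; y2'] -> z \notin L by case/yL.
by split; rewrite /K inE eqxx ?orbT andbT card_edge // nyL // !inE eqxx ?orbT.
Qed.

Lemma HM''_r_graph : r_graph r K.
Proof. by move=> e; rewrite /K inE => /andP[/eqP]. Qed.

(** Edges through [x] share [x], and the two edges avoiding [x] share [L], which is not empty. An
    edge through [x] meets [L], or else meets both pairs [{y1, y1'}] and [{y2, y2'}]. *)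
Lemma HM''_intersecting : intersecting K.
Proof.
have /card_gt0P[l Ll] : 0 < #|L| by rewrite cardL; lia.
move=> e f; rewrite /K !inE => /andP[_ He] /andP[_ Hf]; apply/set0Pn.
suff: exists2 z, z \in e & z \in f by move=> [z]; exists z; rewrite inE; apply/andP.
case/or4P: He => [/andP[xe /pred0Pn[z /= /andP[ez Lz]]]|/and3P[xe e1 e2]|/eqP->|/eqP->].
- case/or4P: Hf => [/andP[xf _]|/and3P[xf _ _]|/eqP->|/eqP->]; try by exists x.
    by exists z; rewrite // inE Lz.
  by exists z; rewrite // inE Lz.
- case/or4P: Hf => [/andP[xf _]|/and3P[xf _ _]|/eqP->|/eqP->]; try by exists x.
    by case/orP: e1 => ?; [exists y1 | exists y1'] => //; rewrite !inE eqxx ?orbT.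
  by case/orP: e2 => ?; [exists y2 | exists y2'] => //; rewrite !inE eqxx ?orbT.
- case/or4P: Hf => [/andP[xf /pred0Pn[z /= /andP[fz Lz]]]|/and3P[xf f1 f2]|/eqP->|/eqP->].
  + by exists z; rewrite // inE Lz.
  + by case/orP: f1 => ?; [exists y1 | exists y1'] => //; rewrite !inE eqxx ?orbT.
  + by exists l; rewrite inE Ll.
  + by exists l; rewrite inE Ll.
- case/or4P: Hf => [/andP[xf /pred0Pn[z /= /andP[fz Lz]]]|/and3P[xf f1 f2]|/eqP->|/eqP->].
  + by exists z; rewrite // inE Lz.
  + by case/orP: f2 => ?; [exists y2 | exists y2'] => //; rewrite !inE eqxx ?orbT.
  + by exists l; rewrite inE Ll.
  + by exists l; rewrite inE Ll.
Qed.

(** If [P] missed [x], some pair [{x, l}] or the triple [{x, y1, y2}] would extend to an edge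
    avoiding [P]. So [P] contains [x], and its other vertex must meet both edges avoiding [x], which
    have only [L] in common. *)
Lemma HM''_transversal2 (P : {set T}) :
    r + 2 <= #|T| -> #|P| <= 2 -> meets_all K P ->
  exists2 l, l \in L & P = [set x; l].
Proof.
move=> le_rT le_P2 KP; have [Ky1 Ky2] := HM''_fixed_edges.
have Px : x \in P.
  apply/negPn/negP=> nPx.
  have avoid (Q : {set T}) : x \in Q -> #|Q| <= r -> [disjoint Q & P] ->
      (forall e : {set T}, #|e| = r -> Q \subset e -> e \in K) -> False.
    move=> Qx le_Qr dQP QK.
    have [|e [Qe er dQ]] := exists_superset_avoiding dQP le_Qr; first lia.
    have /meets_allP/(_ e (QK e er Qe))[v Pv ev] := KP.
    by rewrite (disjointFr dQ ev) in Pv.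
  have [sLP | /subsetPn[l Ll nPl]] := boolP (L \subset P).
    (* Here [L] has [r - 2 >= 2] elements and so fills [P]; the triple [{x, y1, y2}] is then
       disjoint from [P]. *)
    have eqLP : L = P by apply/eqP; rewrite eqEcard sLP cardL; lia.
    have [_ ny1] : (y1 == x) = false /\ y1 \notin L by apply: yL; rewrite !inE eqxx.
    have [_ ny2] : (y2 == x) = false /\ y2 \notin L.
      by apply: yL; rewrite !inE eqxx ?orbT.
    apply: (avoid [set x; y1; y2]).
    - by rewrite !inE eqxx.
    - by rewrite (leq_trans (leq_card_setU _ _)) // cards1 cards2; case: eqP; lia.
    - by rewrite disjoints_subset !subUset !sub1set !inE -eqLP xL ny1 ny2.
    move=> e er; rewrite !subUset !sub1set /K inE er eqxx => /andP[/andP[-> ->] ->].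
    by rewrite orbT.
  apply: (avoid [set x; l]).
  - by rewrite !inE eqxx.
  - by rewrite cards2; case: eqP; lia.
  - by rewrite disjoints_subset !subUset !sub1set !inE nPx nPl.
  move=> e er; rewrite !subUset !sub1set /K inE er eqxx => /andP[-> le].
  by apply/orP; left; apply/pred0Pn; exists l; rewrite /= le.
have P2 q : q \in P -> (q == x) = false -> P = [set x; q].
  move=> Pq nqx; apply/esym/eqP; rewrite eqEcard subUset !sub1set Px Pq cards2.
  by rewrite eq_sym nqx.
have [q Pq] := meets_allP _ _ KP _ Ky1; rewrite inE => /orP[Lq | q1].
  by exists q => //; apply: P2 => //; apply/negP=> /eqP eqx; move: xL; rewrite -eqx Lq.
have [q' Pq'] := meets_allP _ _ KP _ Ky2; rewrite inE => /orP[Lq | q2].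
  by exists q' => //; apply: P2 => //; apply/negP=> /eqP eqx; move: xL; rewrite -eqx Lq.
have [qx _] : (q == x) = false /\ q \notin L.
  by apply: yL; move: q1; rewrite !inE => /orP[]->; rewrite ?orbT.
have [q'x _] : (q' == x) = false /\ q' \notin L.
  by apply: yL; move: q2; rewrite !inE => /orP[]->; rewrite ?orbT.
move: Pq'; rewrite (P2 q Pq qx) !inE q'x /= => /eqP eqq; move: q1 q2.
have [_ /=] := V; rewrite !inE eqq !negb_or.
move=> /and5P[_ /and3P[_ a b] /andP[c d] _ _] _ /orP[]/eqP-> /orP[]/eqP e; 
by move: a b c d; rewrite e eqxx.
Qed.

Lemma HM''_not_sub_some_HM : r + 2 <= #|T| -> ~ sub_some_HM r K.
Proof.
move=> le_rT [[t [_ [u [xs [ys [Uu sub]]]]]] | [r4 [a [b [c [Uabc sub]]]]]].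
  (* Every edge of [HM] either contains [u] or contains all the entries of [xs]. *)
  have tr i : meets_all K [set u; tnth xs i].
    apply/meets_allP=> e /(subsetP sub); rewrite inE => /andP[_].
    case/or3P=> [/existsP[j]|/existsP[j /eqP->]|/andP[_]]; rewrite ?subUset ?sub1set.
    - by case/andP=> ue _; exists u; rewrite // !inE eqxx.
    - by exists (tnth xs i); rewrite !inE ?eqxx ?mem_tnth ?orbT.
    - by case/andP=> ue _; exists u; rewrite // !inE eqxx.
  move: Uu; rewrite cons_uniq cat_uniq mem_cat negb_or -andbA.
  move=> /and4P[uxs _ Uxs _].
  have trE i : exists2 l, l \in L & [set u; tnth xs i] = [set x; l].
    by apply: HM''_transversal2 (tr i); rewrite // cards2; case: eqP.
  (* If [u] differed from [x], all entries of [xs] would equal [x]; but there are at least two of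
     them, and they are distinct. *)
  have xu : x = u.
    apply/eqP; apply/negPn/negP=> nxu.
    have xi i : tnth xs i = x.
      have [l _ /setP/(_ x)] := trE i.
      by rewrite !inE eqxx (negPf nxu) /= => /eqP.
    have lt0 : 0 < r.-1 by lia.
    have lt1 : 1 < r.-1 by lia.
    have := xi (Ordinal lt0); rewrite -(xi (Ordinal lt1)).
    by move/(tuple_uniqP _ Uxs)/(congr1 val).
  (* This puts [r - 1] distinct vertices into [L], which has only [r - 2]. *)
  have: [set:: xs] \subset L.
    apply/subsetP=> z; rewrite inE => /tnthP[i ->].
    have [l Ll /setP/(_ (tnth xs i))] := trE i; rewrite !inE eqxx orbT.
    case/esym/orP=> /eqP eqz; last by rewrite eqz.
    by rewrite -xu -eqz mem_tnth in uxs.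
  move/subset_leq_card; rewrite card_set_uniq // size_tuple cardL; lia.
(* An edge of [HM0] missing [p] and [q] would meet the triple in [s] alone. So all three pairs from
   [a], [b], [c] are transversals and contain [x], although no vertex lies in all three. *)
have tr (p q s : T) : [set p; q; s] = [set a; b; c] -> p != q -> x \in [set p; q].
  move=> eq_s npq; have [||l _ ->] := @HM''_transversal2 [set p; q] le_rT.
  - by rewrite cards2 npq.
  - apply/meets_allP=> e /(subsetP sub); rewrite inE -eq_s => /andP[_].
    have [/existsP[v /andP[pv ev]] _|] :=
        boolP [exists v, (v \in [set p; q]) && (v \in e)].
      by exists v.
    move/existsPn=> no; rewrite ltnNge => /negP[]; rewrite -(cards1 s).
    apply/subset_leq_card/subsetP=> z; rewrite !inE => /andP[ez].
    by have := no z; rewrite !inE ez andbT negb_or => /andP[/negPf-> /negPf->].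
  - by rewrite !inE eqxx.
move: Uabc; rewrite /= !inE negb_or => /and3P[/andP[ab ac] bc _].
have := tr a b c erefl ab.
have := tr a c b (setUAC _ _ _) ac.
have := tr b c a _ bc; rewrite (setUC [set b; c]) setUA => /(_ erefl).
rewrite !inE => /orP[]/eqP-> /orP[]/eqP e1 /orP[]/eqP e2; move: ab ac bc.
all: by rewrite ?e1 ?e2 ?eqxx // -?e1 -?e2 ?eqxx // e2 eqxx.
Qed.

Lemma HM''_tau : r + 2 <= #|T| -> 2 <= tau K.
Proof.
move=> le_rT; apply/tau_gtP.
  by apply: meets_all_setT HM''_r_graph; lia.
move=> S KS; rewrite ltnNge; apply/negP=> le_S1.
have [|l Ll defS] := HM''_transversal2 le_rT _ KS; first exact: leq_trans le_S1 _.
move: le_S1; rewrite defS cards2; case: eqP => // eqx _; move: xL.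
by rewrite eqx Ll.
Qed.

End Sharpness.

(** * Two-element covers of graphs without a one-element cover *)

Lemma set2_eq (T : finType) (P : {set T}) u v :
  #|P| = 2 -> u \in P -> v \in P -> u != v -> P = [set u; v].
Proof.
move=> cP Pu Pv uv; apply/esym/eqP.
by rewrite eqEcard subUset !sub1set Pu Pv cards2 uv cP.
Qed.

Section GraphCovers.

Variables (T : finType) (G : {set {set T}}).
Implicit Types (g P : {set T}).
Hypothesis G2 : forall g, g \in G -> #|g| = 2.
Hypothesis tauG : forall S : {set T}, meets_all G S -> 2 <= #|S|.

Let Cv := [set P : {set T} | (#|P| == 2) && meets_all G P].

Let Cv2 P : P \in Cv -> #|P| = 2.
Proof. by rewrite inE => /andP[/eqP]. Qed.

Let CvG P g : P \in Cv -> g \in G -> exists2 v, v \in P & v \in g.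
Proof. by rewrite inE => /andP[_ /meets_allP GP] /GP. Qed.

Let miss v : exists2 g, g \in G & v \notin g.
Proof.
have: ~~ meets_all G [set v] by apply/negP=> /tauG; rewrite cards1.
by case/not_meets_allP=> g Gg vg; exists g; rewrite ?vg ?set11.
Qed.

(** Given disjoint edges [g1] and [g2], a cover takes one vertex from each, so there are at most
    four. If all four are covers, an edge containing neither [g1] nor [g2] would be missed by one of
    them. *)
Lemma card_cover2_leq3 :
  (exists g1 g2, [/\ [disjoint g1 & g2], #|g1| = 2, #|g2| = 2 & G = [set g1; g2]])
  \/ #|Cv| <= 3.
Proof.
have [/existsP[g1 /existsP[g2 /and3P[Gg1 Gg2 d12]]] | no] :=
  boolP [exists g1, exists g2, [&& g1 \in G, g2 \in G & [disjoint g1 & g2]]].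
  pose Q := [set [set u.1; u.2] | u in setX g1 g2].
  have CvQ : Cv \subset Q.
    apply/subsetP=> P CP.
    have [u Pu u1] := CvG CP Gg1; have [v Pv v2] := CvG CP Gg2.
    apply/imsetP; exists (u, v); first by rewrite inE u1 v2.
    apply: set2_eq => //; first exact: Cv2.
    by apply/negP=> /eqP /= equv; move: (disjointFr d12 u1); rewrite equv v2.
  have le_Q4 : #|Q| <= 4.
    by apply: leq_trans (leq_imset_card _ _) _; rewrite cardsX !G2.
  have [sQC | nsQC] := boolP (Q \subset Cv); last first.
    right; rewrite -ltnS; apply: leq_trans le_Q4; apply: proper_card.
    by rewrite properE CvQ.
  left; exists g1, g2; rewrite !G2 //; split=> //; apply/eqP.
  rewrite eqEsubset subUset !sub1set Gg1 Gg2 !andbT; apply/subsetP=> g Gg.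
  have [s1 | /subsetPn[u u1 ug]] := boolP (g1 \subset g).
    by rewrite !inE; apply/orP; left; rewrite eq_sym eqEcard s1 !G2.
  have [s2 | /subsetPn[v v2 vg]] := boolP (g2 \subset g).
    by rewrite !inE; apply/orP; right; rewrite eq_sym eqEcard s2 !G2.
  have /(subsetP sQC) CQ : [set u; v] \in Q.
    by apply/imsetP; exists (u, v); rewrite ?inE ?u1.
  have [z] := CvG CQ Gg.
  by rewrite !inE => /orP[] /eqP->; rewrite ?(negPf ug) ?(negPf vg).
(* Pairwise intersecting edges with no common vertex contain a triangle, and a two-element cover of
   a triangle is one of its sides. *)
have meet g g' : g \in G -> g' \in G -> exists2 v, v \in g & v \in g'.
  move=> Gg Gg'; move/existsPn/(_ g)/existsPn/(_ g'): no.
  by rewrite Gg Gg' => /pred0Pn[v /andP[]]; exists v.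
right; have [g1 Gg1] : exists g, g \in G.
  apply/set0Pn/negP=> /eqP G0; have: meets_all G set0.
    by apply/forall_inP=> g; rewrite G0 inE.
  by move/tauG; rewrite cards0.
have /eqP/cards2P[a [b [ab def1]]] := G2 Gg1.
have [ga Gga na] := miss a; have [gb Ggb nb] := miss b.
have ba : b \in ga.
  have [v] := meet _ _ Gg1 Gga; rewrite def1 !inE => /orP[]/eqP-> //.
  by rewrite (negPf na).
have abb : a \in gb.
  have [v] := meet _ _ Gg1 Ggb; rewrite def1 !inE => /orP[]/eqP-> //.
  by rewrite (negPf nb).
have [c ca cb] := meet _ _ Gga Ggb.
have bc : b != c by apply/negP=> /eqP eqbc; rewrite eqbc cb in nb.
have ac : a != c by apply/negP=> /eqP eqac; rewrite eqac ca in na.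
have defa : ga = [set b; c] by apply: set2_eq; rewrite ?G2.
have defb : gb = [set a; c] by apply: set2_eq; rewrite ?G2.
have: Cv \subset [:: [set a; b]; [set a; c]; [set b; c]].
  apply/subsetP=> P CP; have P2 := Cv2 CP; rewrite !inE.
  have [u Pu] := CvG CP Gg1; have [v Pv] := CvG CP Gga.
  have [w Pw] := CvG CP Ggb; rewrite def1 defa defb !inE.
  have Pab := fun Pa Pb => set2_eq P2 Pa Pb ab.
  have Pac := fun Pa Pc => set2_eq P2 Pa Pc ac.
  have Pbc := fun Pb Pc => set2_eq P2 Pb Pc bc.
  move=> /orP[]/eqP ew /orP[]/eqP ev /orP[]/eqP eu; subst u v w;
    first [by rewrite Pab ?eqxx | by rewrite Pac ?eqxx ?orbT
          | by rewrite Pbc ?eqxx ?orbT].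
by move/subset_leq_card/leq_trans; apply; apply: card_size.
Qed.

(** Each cover in [Cv] costs [G] one unit of the leading term, which is what that cover will
    contribute when larger covers are counted. The edges of [G] must in turn meet every member of
    [Cv]. *)
Lemma card_graph_cover2 k :
    #|Cv| <= 3 -> 0 < k -> k.*2 <= #|T| ->
    (Cv = set0 -> #|G| <= 3 * 'C(#|T|, k)) ->
  #|G| <= (3 - #|Cv|) * 'C(#|T|, k) + 4 * 'C(#|T|, k.-1).
Proof.
move=> le_C3 k_gt0 le_kT G0.
have C_gt0 : 0 < 'C(#|T|, k.-1) by rewrite bin_gt0; lia.
have le_TC : #|T| <= 'C(#|T|, k) by rewrite -{1}(bin1 #|T|) leq_bin2r //; lia.
have [/existsP[p Cp] | nCp] := boolP [exists p, meets_all Cv [set p]]; last first.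
  (* No single vertex meets all of [Cv], so two guesses, each within a pair, determine an edge of
     [G]. *)
  apply: (@leq_trans 4); last by rewrite (leq_trans _ (leq_addl _ _)) // leq_pmulr.
  apply: leq_trans (_ : 2 ^ 2 * 'C(#|T|, 2 - (#|@set0 T| + 2)) <= _); last first.
    by rewrite cards0 bin0.
  apply: (@card_family_branch _ Cv); first by move=> P /Cv2->.
    move=> g Gg; rewrite G2 ?sub0set //; split=> //.
    by apply/meets_allP=> P CP; have [v] := CvG CP Gg; exists v.
  move=> g U Gg _; rewrite cards0 ltnS => le_U1.
  have [p Up] : exists p, U \subset [set p].
    have [v _] : exists v, v \in g by apply/card_gt0P; rewrite G2.
    case: (posnP #|U|) => [/cards0_eq-> | U_gt0]; first by exists v; rewrite sub0set.
    have /cards1P[p ->] : #|U| == 1 by rewrite eqn_leq le_U1.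
    by exists p.
  by apply/negP=> /(meets_allS Up) Cp; case/existsP: nCp; exists p.
have {}Cp P : P \in Cv -> p \in P.
  by move/(meets_allP _ _ Cp)=> [v]; rewrite inE => /eqP->.
have [C0 | [P CP]] := set_0Vmem Cv.
  by rewrite C0 cards0; apply: leq_trans (G0 C0) (leq_addr _ _).
(* Some edge [g0] avoids [p], and the second vertex of each cover lies in [g0]. *)
have le_C2 : #|Cv| <= 2.
  have [g0 Gg0 pg0] := miss p; rewrite -(G2 Gg0).
  apply: leq_trans (leq_imset_card (fun z => [set p; z]) _).
  apply/subset_leq_card/subsetP=> Q CQ; have [z Qz gz] := CvG CQ Gg0.
  apply/imsetP; exists z => //; apply: set2_eq; rewrite ?Cv2 ?Cp //.
  by apply/negP=> /eqP eqpz; rewrite eqpz gz in pg0.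
have C_ge1 : 0 < #|Cv| by apply/card_gt0P; exists P.
move: le_C2; rewrite leq_eqVlt => /orP[/eqP C2 | C1].
  have [Q CQ nQP] : exists2 Q, Q \in Cv & Q != P.
    have: 0 < #|Cv :\ P| by have := cardsD1 P Cv; rewrite CP C2; lia.
    by case/card_gt0P=> Q; rewrite !inE => /andP[? ?]; exists Q; rewrite ?inE.
  have other R : R \in Cv -> exists q, R = [set p; q].
    move=> CR; have : 0 < #|R :\ p|.
      by have := cardsD1 p R; rewrite Cp // Cv2 //; lia.
    case/card_gt0P=> q; rewrite !inE => /andP[nqp Rq]; exists q.
    by apply: set2_eq; rewrite ?Cv2 ?Cp // eq_sym.
  have [q defP] := other P CP; have [s defQ] := other Q CQ.
  have nqs : q != s by apply: contraNneq nQP => eqqs; rewrite defP defQ eqqs.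
  (* With covers [{p, q}] and [{p, s}], an edge avoiding [p] must be [{q, s}]. *)
  have sG : G \subset [set g in G | p \in g] :|: [set [set q; s]].
    apply/subsetP=> g Gg; rewrite !inE Gg /=; case pg: (p \in g) => //=.
    apply/eqP/set2_eq; rewrite ?G2 //.
    - have [v] := CvG CP Gg; rewrite defP !inE.
      by case/orP=> /eqP-> //; rewrite pg.
    - have [v] := CvG CQ Gg; rewrite defQ !inE.
      by case/orP=> /eqP-> //; rewrite pg.
  apply: leq_trans (subset_leq_card sG) _; apply: leq_trans (leq_card_setU _ _) _.
  have : #|[set g in G | p \in g]| <= 'C(#|T|, 2 - #|[set p]|).
    apply: card_family_supersets => g; rewrite inE => /andP[/G2 // _ pg].
    by rewrite sub1set.
  rewrite cards1 cards1 bin1 C2; nia.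
have -> : #|Cv| = 1 by lia.
have : #|G| <= #|[set [set v] | v in P]| * 'C(#|T|, 2 - 1).
  apply: card_family_cover => //.
    by move=> _ /imsetP[v _ ->]; rewrite cards1.
  move=> g Gg; have [v Pv gv] := CvG CP Gg.
  by exists [set v]; rewrite ?sub1set //; apply: imset_f.
have : #|[set [set v] | v in P]| <= 2.
  by rewrite -(Cv2 CP) leq_imset_card.
rewrite bin1; nia.
Qed.

(** Members of [A] containing a two-element cover number at most [#|Cv| * 'C(#|T|, k)]. The others
    are found by three guesses among two vertices, whence the error constant 12 = 4 + 2^3. *)
Lemma card_graph_and_covers k (A : {set {set T}}) :
    0 < k -> k.*2 <= #|T| ->
    (forall e, e \in A -> #|e| = k.+2 /\ meets_all G e) ->
    (1 < k \/ A != set0) ->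
  (exists g1 g2, [/\ [disjoint g1 & g2], #|g1| = 2, #|g2| = 2 & G = [set g1; g2]])
  \/ #|A| + #|G| <= 3 * 'C(#|T|, k) + 12 * 'C(#|T|, k.-1).
Proof.
move=> k_gt0 le_kT Aprops k1A.
have [|le_C3] := card_cover2_leq3; [by left | right].
(* Without two-element covers, [G] is bounded by all pairs when [k > 1]. When [k = 1] there would be
   too many pairs, and a three-element cover in [A] is used instead. *)
have leG : #|G| <= (3 - #|Cv|) * 'C(#|T|, k) + 4 * 'C(#|T|, k.-1).
  apply: card_graph_cover2 => // C0; case: (ltnP 1 k) => [k_gt1 | k_le1].
    have : #|G| <= 'C(#|T|, 2 - #|@set0 T|).
      by apply: card_family_supersets => // g _; rewrite sub0set.
    rewrite cards0 subn0; have := @leq_bin2r #|T| 2 k k_gt1; lia.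
  case: k1A => [|/set0Pn[e Ae]]; first by lia.
  have k1 : k = 1 by lia.
  have [ce Ge] := Aprops e Ae.
  have : #|G| <= #|[set [set v] | v in e]| * 'C(#|T|, 2 - 1).
    apply: card_family_cover => //.
      by move=> _ /imsetP[v _ ->]; rewrite cards1.
    move=> g Gg; have [v ev gv] := meets_allP _ _ Ge g Gg.
    by exists [set v]; rewrite ?sub1set //; apply: imset_f.
  have : #|[set [set v] | v in e]| <= 3.
    by apply: leq_trans (leq_imset_card _ _) _; rewrite ce k1.
  rewrite subSS subn0 k1 !bin1 => le_s3 le_G; apply: leq_trans le_G _.
  by rewrite leq_mul2r le_s3 orbT.
pose A2 := [set e in A | [exists P in Cv, P \subset e]].
have le_A2 : #|A2| <= #|Cv| * 'C(#|T|, k.+2 - 2).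
  apply: card_family_cover => // e; rewrite inE => /andP[/Aprops[] //].
  by move=> _ _ /exists_inP.
have le_A3 : #|A :\: A2| <= 2 ^ 3 * 'C(#|T|, k.+2 - (#|@set0 T| + 3)).
  apply: (@card_family_branch _ G); first by move=> g /G2->.
    by move=> e; rewrite inE => /andP[_ /Aprops[]]; rewrite sub0set.
  move=> e U; rewrite !inE cards0 => /andP[nA2 Ae] Ue lt_U3; apply/negP=> GU.
  have le_U2 := tauG GU; case/negP: nA2; rewrite Ae; apply/exists_inP; exists U => //.
  by rewrite inE GU andbT; lia.
have := cardsID A2 A; have -> : A :&: A2 = A2.
  by apply/setIidPr/subsetP=> e; rewrite inE => /andP[].
rewrite cards0 in le_A3; have e1 : k.+2 - 2 = k by lia.
have e2 : k.+2 - (0 + 3) = k.-1 by lia.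
rewrite e1 in le_A2; rewrite e2 in le_A3.
nia.
Qed.

End GraphCovers.

(** * Inequalities required of n *)

(* The first inequality says that r - 3 leaves are too few, the second that
   three 3-element transversals through [x] are too few. *)
Definition large_enough r n :=
  (r - 3) * 'C(n, r - 2) + r ^ 3 * 'C(n, r - 3)
    <= (r - 2) * 'C(n - r.-1, r - 2)
  /\ 3 * 'C(n, r - 3) + 12 * 'C(n, r - 4) <= 4 * 'C(n - (r + 3), r - 3).

Lemma large_enough_eventually r :
  4 <= r -> exists N, forall n, N <= n -> large_enough r n.
Proof.
move=> r_ge4.
have [N1 dom1] := bin_dominates ((r - 3) * r.-1 + r ^ 3) r.-1 (r - 3).
have [N2 dom2] := bin_dominates (3 * (r + 3) + 12) (r + 3) (r - 4).
have e3 : r - 3 = (r - 4).+1 by lia.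
have e2 : r - 2 = (r - 3).+1 by lia.
(* Here [a] is the leading binomial at [n], [d] the same binomial at the shifted argument, and [b]
   one of lower order. The spare copy of [d] absorbs both the shift and the error term. *)
have combine p a b d q s :
    a <= d + q * b -> (p * q + s) * b <= d -> p * a + s * b <= p.+1 * d.
  move=> le_a le_b; apply: leq_trans (leq_add (leq_mul (leqnn p) le_a) (leqnn _)) _.
  by rewrite mulnDr mulnA -addnA -mulnDl mulSnr leq_add2l.
exists (N1 + N2) => n le_Nn; split.
  rewrite [in X in _ <= X * _]e2; apply: (combine _ _ _ _ r.-1).
    by rewrite e2 bin_subl_leq.
  by rewrite e2 dom1 //; lia.
apply: (combine 3 _ _ _ (r + 3)); first by rewrite e3 bin_subl_leq.
by rewrite e3 dom2 //; lia.
Qed.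

(** * Lower bounds for HM''(n,r), and an upper bound for HM(n,r,0) *)

Section LowerBounds.

Variables (r : nat) (T : finType) (x : T) (L : {set T}) (y1 y1' y2 y2' : T).
Hypotheses (r_ge4 : 4 <= r) (V : HM''_vertices r x L y1 y1' y2 y2').
Let K := HM''_set r x L y1 y1' y2 y2'.

(** The bulk of HM''(n,r). Bounds on competing families are stated relative to it, so that it
    cancels and only lower-order terms are compared. *)
Definition star_meeting (v : T) (X : {set T}) : {set {set T}} :=
  [set e : {set T} | [&& #|e| == r, v \in e & ~~ [disjoint e & X]]].

Let cardL : #|L| = r - 2. Proof. by case: V => ->; lia. Qed.
Let xL : x \notin L. Proof. by case: V => _ _; apply; rewrite mem_head. Qed.

(** Counts only the edges whose trace on [x |: L] is [{x, l}] with [l] in [L]. *)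
Lemma card_HM''_ge_bin : (r - 2) * 'C(#|T| - r.-1, r - 2) <= #|K|.
Proof.
pose P := [set [set x; l] | l in L].
have cP : #|P| = r - 2.
  rewrite card_in_imset // => l l' Ll Ll' /setP/(_ l); rewrite !inE eqxx orbT.
  by case/esym/orP=> /eqP // eqlx; move: xL; rewrite -eqlx Ll.
have cZ : #|x |: L| = r.-1 by rewrite cardsU1 xL cardL; lia.
rewrite -cP -{1}cZ; apply: card_family_traces.
  by move=> _ /imsetP[l Ll ->]; rewrite subUset !sub1set !inE eqxx Ll orbT.
move=> _ A /imsetP[l Ll ->] AZ cA; have nxl : x != l.
  by apply/negP=> /eqP eqxl; move: xL; rewrite eqxl Ll.
rewrite /K !inE; apply/andP; split.
  rewrite cardsU cards2 nxl cA disjoint_setI0 ?cards0; first lia.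
  rewrite disjoint_sym; apply: disjointWr (_ : _ \subset x |: L) _.
    by rewrite subUset !sub1set !inE eqxx Ll orbT.
  by rewrite disjoints_subset.
by rewrite eqxx; apply/orP; left; apply/pred0Pn; exists l; rewrite /= !inE eqxx Ll orbT.
Qed.

(** Outside the star, it suffices to count edges whose trace on the [r + 3] special vertices is one
    of four triples: [x] with one vertex from each pair. *)
Lemma card_HM''_ge_star :
  #|star_meeting x L| + 4 * 'C(#|T| - (r + 3), r - 3) <= #|K|.
Proof.
pose Z := L :|: [set:: [:: x; y1; y1'; y2; y2']].
have [_ Uy yL] := V.
have dLZ : L :&: [set:: [:: x; y1; y1'; y2; y2']] = set0.
  apply/setP=> z; rewrite !inE; apply/negP=> /andP[Lz zy].
  by have := yL z; rewrite !inE zy Lz => /(_ isT).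
have cZ : #|Z| = r + 3.
  by rewrite cardsU dLZ cards0 card_set_uniq //= cardL; lia.
pose P := [set [set x; u.1; u.2] | u in setX [set y1; y1'] [set y2; y2']].
have xy z : z \in [:: y1; y1'; y2; y2'] -> (z == x) = false.
  by move: Uy => /andP[xy _] zy; apply: contraNF xy => /eqP <-.
have yy u v : u \in [:: y1; y1'] -> v \in [:: y2; y2'] -> (u == v) = false.
  move: Uy; rewrite (cat_uniq [:: x; y1; y1'] [:: y2; y2']).
  case/and3P=> _ /hasPn no _ uy vy; apply: contraNF (no v vy) => /eqP <-.
  by rewrite in_cons uy orbT.
have cP : #|P| = 4.
  rewrite card_in_imset.
    move: Uy; rewrite cardsX !cards2 /= !inE !negb_or.
    by case/and5P=> _ /andP[-> _] _ ->.
  move=> [a b] [a' b']; rewrite ![_ \in setX _ _]inE /= !in_set2 -!mem_seq2.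
  move=> /andP[Ha Hb] /andP[Ha' Hb'] /setP eqs.
  have := eqs a; have := eqs b; rewrite !inE !eqxx !orbT.
  rewrite (eq_sym b a') (yy a' b) // (yy a b') //.
  have xa : (a == x) = false by apply: xy; rewrite (mem_cat _ [:: y1; y1']) Ha.
  have xb : (b == x) = false.
    by apply: xy; rewrite (mem_cat _ [:: y1; y1']) Hb orbT.
  by rewrite xa xb !orbF /= => /esym/eqP-> /esym/eqP->.
have sK : star_meeting x L \subset K.
  by apply/subsetP=> e; rewrite /K !inE => /and3P[-> -> ->].
have := cardsID (star_meeting x L) K; rewrite (setIidPr sK) => <-.
rewrite leq_add2l -cP -cZ; apply: card_family_traces.
  move=> _ /imsetP[[a b] /setXP[Ha Hb] ->]; apply/subsetP=> z.
  move: Ha Hb; rewrite /Z !inE => /orP[]/eqP-> /orP[]/eqP-> /orP[/orP[]|]/eqP->;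
  by rewrite eqxx !orbT.
move=> _ A /imsetP[[a b] /setXP[/= Ha Hb] ->] AZ cA.
have Ha' : a \in [:: y1; y1'] by move: Ha; rewrite !inE.
have Hb' : b \in [:: y2; y2'] by move: Hb; rewrite !inE.
have Hay : a \in [:: y1; y1'; y2; y2'] by rewrite (mem_cat _ [:: y1; y1']) Ha'.
have Hby : b \in [:: y1; y1'; y2; y2'].
  by rewrite (mem_cat _ [:: y1; y1']) Hb' orbT.
have nZ z : z \in L \/ z \in [:: x; y1; y1'; y2; y2'] -> z \notin A.
  move=> zZ; apply/negP=> /(subsetP AZ); rewrite !inE negb_or => /andP[zL].
  by case: zZ => [Lz|]; [rewrite Lz in zL | rewrite !inE => ->].
have dL : [disjoint [set x; a; b] :|: A & L].
  rewrite disjoints_subset; apply/subsetP=> z; rewrite !inE => zA.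
  apply/negP=> Lz; have nzA := nZ z (or_introl Lz).
  move: zA; rewrite (negPf nzA) orbF => /orP[/orP[]|]/eqP eqz; subst z.
  - by move: xL; rewrite Lz.
  - by have := yL a; rewrite in_cons Hay orbT Lz => /(_ isT).
  - by have := yL b; rewrite in_cons Hby orbT Lz => /(_ isT).
have cab : #|[set x; a; b] :|: A| = r.
  rewrite cardsU disjoint_setI0.
    rewrite cards0 cA -setUA cardsU1 cards2 !inE (eq_sym x) (xy a) // (eq_sym x).
    by rewrite (xy b) // (yy a b) //= subn0; apply: subnKC (ltnW r_ge4).
  rewrite disjoints_subset !subUset !sub1set !inE !nZ //; right;
    by rewrite ?mem_head // in_cons ?Hay ?Hby orbT.
rewrite /K !inE cab dL !eqxx /=.
move: Ha Hb; rewrite !inE => /orP[]/eqP-> /orP[]/eqP->;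
by rewrite !eqxx ?orbT.
Qed.

End LowerBounds.

(* Edges of HM(n,r,0) through [a] lie in the star; in the other edges, which
   contain [b] and [c], these two are traded for [a] and a third vertex [d] of
   [L], the edges already containing [d] being negligible. *)
Lemma card_HM0_leq r (T : finType) (a b c : T) (L : {set T}) :
    4 < r -> uniq [:: a; b; c] -> a \notin L -> b \in L -> c \in L ->
    2 < #|L| ->
  #|HM0 r a b c| <= #|star_meeting r a L| + 'C(#|T|, r - 3).
Proof.
move=> r_gt4 /= /and3P[]; rewrite !inE negb_or => /andP[ab ac] bc _ aL Lb Lc L3.
have HM0P e : e \in HM0 r a b c -> [/\ #|e| = r, a \in e -> (b \in e) || (c \in e)
    & a \notin e -> (b \in e) && (c \in e)].
  rewrite inE => /andP[/eqP er le2]; split=> // ae.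
    apply: contraTT le2; rewrite negb_or -ltnNge ltnS => /andP[nb nc].
    rewrite -(cards1 a); apply/subset_leq_card/subsetP=> z; rewrite !inE.
    by case/andP=> ze /orP[/orP[]|]/eqP eqz //; subst z; rewrite ?eqxx //;
       [rewrite (negPf nb) in ze | rewrite (negPf nc) in ze].
  apply: contraTT le2; rewrite negb_and -ltnNge ltnS => nbc.
  have [z0 nz0] : exists z0, e :&: [set a; b; c] \subset [set z0].
    case/orP: nbc => [nb|nc]; [exists c | exists b]; apply/subsetP=> z; rewrite !inE.
      by case/andP=> ze /orP[/orP[]|]/eqP eqz; subst z; rewrite ?eqxx //;
         [rewrite (negPf ae) in ze | rewrite (negPf nb) in ze].
    by case/andP=> ze /orP[/orP[]|]/eqP eqz; subst z; rewrite ?eqxx //;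
       [rewrite (negPf ae) in ze | rewrite (negPf nc) in ze].
  by rewrite -(cards1 z0) subset_leq_card.
have [d Ld /andP[db dc]] : exists2 d, d \in L & (d != b) && (d != c).
  have: 0 < #|L :\ b :\ c|.
    have := cardsD1 b L; have := cardsD1 c (L :\ b).
    by rewrite !inE Lb Lc eq_sym bc /=; lia.
  by case/card_gt0P=> d; rewrite !inE => /and3P[dc db Ld]; exists d; rewrite ?db.
have ad : a != d by apply: contraNneq aL => ->.
pose F1 := [set e in HM0 r a b c | a \in e].
pose F2 := [set e in HM0 r a b c | (a \notin e) && (d \notin e)].
pose F3 := [set e in HM0 r a b c | (a \notin e) && (d \in e)].
have leF : #|HM0 r a b c| <= #|F1| + #|F2| + #|F3|.
  apply: leq_trans (_ : #|F1 :|: F2 :|: F3| <= _).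
    apply/subset_leq_card/subsetP=> e He; rewrite !in_setU.
    rewrite [e \in F1]in_set [e \in F2]in_set [e \in F3]in_set He.
    by case: (a \in e); case: (d \in e).
  apply: leq_trans (leq_card_setU _ _) _; rewrite leq_add2r.
  exact: leq_card_setU.
have leF3 : #|F3| <= 'C(#|T|, r - #|[set b; c; d]|).
  apply: card_family_supersets => e; rewrite inE => /andP[/HM0P[er _ na] /andP[ae de]] //.
  by rewrite !subUset !sub1set de andbT na.
have c3 : #|[set b; c; d]| = 3.
  by rewrite setUC cardsU1 cards2 !inE negb_or db dc bc.
rewrite c3 in leF3.
pose swap e := a |: (d |: (e :\ b :\ c)).
have swapK : {in F2, forall e, b |: (c |: (swap e :\ a :\ d)) = e}.
  move=> e; rewrite inE => /andP[/HM0P[_ _ na] /andP[ae de]].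
  have /andP[be ce] := na ae; apply/setP=> z; rewrite !inE.
  have [-> //|zb] := eqVneq z b; have [-> //|zc] := eqVneq z c.
  have [->|zd] := eqVneq z d; first by rewrite (negPf de).
  by have [->|za] := eqVneq z a; first by rewrite (negPf ae) !andbF.
have c2 : #|swap @: F2| = #|F2|.
  by apply: card_in_imset => e f Fe Ff eqs; rewrite -(swapK e) // eqs swapK.
have F2P e : e \in F2 ->
    [/\ #|swap e| = r, d \in swap e, b \notin swap e & c \notin swap e].
  rewrite inE => /andP[/HM0P[er _ na] /andP[ae de]]; have /andP[be ce] := na ae.
  split; last 3 first.
  - by rewrite !inE eqxx orbT.
  - by rewrite !inE eqxx /= !(eq_sym b) (negPf ab) (negPf db) andbF.
  - by rewrite !inE eqxx /= !(eq_sym c) (negPf ac) (negPf dc).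
  rewrite /swap !cardsU1 !inE (negPf ad) (negPf ae) (negPf de) !andbF /=.
  have := cardsD1 b e; have := cardsD1 c (e :\ b).
  by rewrite !inE be ce eq_sym bc -er /= => -> ->.
apply: leq_trans leF _; apply: leq_add leF3; rewrite -c2.
(* Swapped edges contain neither [b] nor [c], whereas every edge in [F1] contains one of them. *)
have -> : #|F1| + #|swap @: F2| = #|F1 :|: swap @: F2|.
  rewrite cardsU disjoint_setI0 ?cards0 ?subn0 //.
  apply/pred0P=> e /=; apply/negP=> /andP[]; rewrite inE => /andP[/HM0P[_ ea _]].
  move=> /ea ebc /imsetP[f /F2P[_ _ nb nc] defe].
  by rewrite defe (negPf nb) (negPf nc) in ebc.
apply/subset_leq_card; rewrite subUset; apply/andP; split; apply/subsetP=> e.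
  rewrite inE => /andP[/HM0P[er ea _] ae]; rewrite inE er eqxx ae /=.
  by apply/pred0Pn; case/orP: (ea ae) => ?; [exists b | exists c]; apply/andP.
case/imsetP=> f /F2P[fr df _ _] ->; rewrite inE fr eqxx /=.
apply/andP; split; first by rewrite !inE eqxx.
by apply/pred0Pn; exists d; apply/andP.
Qed.

(** * Maximal intersecting families and their two-element transversals *)

Section Structure.

Variables (r : nat) (T : finType) (H : {set {set T}}).
Hypotheses (r_ge4 : 4 <= r) (le_rT : r + r <= #|T|).
Hypotheses (Hmax : maximal_intersecting r H).
Hypothesis tauH : forall S : {set T}, meets_all H S -> 2 <= #|S|.

Let Hr e : e \in H -> #|e| = r. Proof. by case: Hmax => + _ _; apply. Qed.

Let Hi e f : e \in H -> f \in H -> e :&: f != set0.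
Proof. by case: Hmax => _ + _; apply. Qed.

Let not_transversal1 v : exists2 e, e \in H & v \notin e.
Proof.
have: ~~ meets_all H [set v] by apply/negP=> /tauH; rewrite cards1.
by case/not_meets_allP=> e He ve; exists e; rewrite ?ve ?set11.
Qed.

(** Two-element transversals pairwise meet. If no vertex lies in all of them, take one [{a, b}], one
    avoiding [a] and one avoiding [b]; the last two meet in the third vertex [c]. *)
Lemma triangle_or_star :
  (exists a b c, [/\ uniq [:: a; b; c], meets_all H [set a; b],
                     meets_all H [set a; c] & meets_all H [set b; c]])
  \/ exists x, forall P : {set T}, #|P| = 2 -> meets_all H P -> x \in P.
Proof.
have meet (P Q : {set T}) : #|P| = 2 -> #|Q| = 2 -> meets_all H P ->
    meets_all H Q -> exists2 v, v \in P & v \in Q.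
  move=> cP cQ HP HQ; have := transversals_meet Hmax _ _ HP HQ.
  by rewrite cP cQ => /(_ ltac:(lia) ltac:(lia))/pred0Pn[v /andP[]]; exists v.
have star x : (exists x, forall P : {set T}, #|P| = 2 -> meets_all H P -> x \in P)
    \/ exists P : {set T}, [/\ #|P| = 2, meets_all H P & x \notin P].
  have [/existsP[P /and3P[/eqP ? ? ?]] | no] :=
    boolP [exists P : {set T}, [&& #|P| == 2, meets_all H P & x \notin P]].
    by right; exists P.
  left; exists x => P cP HP; apply/negPn/negP=> xP.
  by case/existsP: no; exists P; rewrite cP HP.
have [x0 _] : exists x0 : T, true.
  by have /card_gt0P[x _] : 0 < #|T| by [lia]; exists x.
have [|[P [cP HP _]]] := star x0; first by right.
have /eqP/cards2P[a [b [ab defP]]] := cP.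
have [|[Q [cQ HQ naQ]]] := star a; first by right.
have [|[R [cR HR nbR]]] := star b; first by right.
have bQ : b \in Q.
  by have [v] := meet _ _ cP cQ HP HQ; rewrite defP !inE => /orP[]/eqP-> //;
     rewrite (negPf naQ).
have aR : a \in R.
  by have [v] := meet _ _ cP cR HP HR; rewrite defP !inE => /orP[]/eqP-> //;
     rewrite (negPf nbR).
have [c Qc Rc] := meet _ _ cQ cR HQ HR; left; exists a, b, c.
have ac : a != c by apply: contraNneq naQ => ->.
have bc : b != c by apply: contraNneq nbR => ->.
rewrite -defP -(set2_eq cR aR Rc ac) -(set2_eq cQ bQ Qc bc); split=> //.
by rewrite /= !inE negb_or ab ac bc.
Qed.

Lemma triangle_sub_HM0 a b c :
    uniq [:: a; b; c] -> meets_all H [set a; b] -> meets_all H [set a; c] ->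
    meets_all H [set b; c] ->
  H \subset HM0 r a b c.
Proof.
rewrite /= !inE negb_or => /and3P[/andP[ab ac] bc _] /meets_allP Hab.
move=> /meets_allP Hac /meets_allP Hbc; apply/subsetP=> e He.
have two u v : u != v -> u \in e -> v \in e -> [set u; v] \subset [set a; b; c] ->
    e \in HM0 r a b c.
  move=> uv ue ve uvs; rewrite inE Hr ?eqxx //= -(_ : #|[set u; v]| = 2).
    by apply: subset_leq_card; rewrite subsetI uvs subUset !sub1set ue ve.
  by rewrite cards2 uv.
have [u] := Hab e He; have [v] := Hac e He; have [w] := Hbc e He.
rewrite !in_set2 => /orP[]/eqP-> ew /orP[]/eqP-> ev /orP[]/eqP-> eu;
first [by apply: (two a b) => //; rewrite subUset !sub1set !inE !eqxx ?orbT
  | by apply: (two a c) => //; rewrite subUset !sub1set !inE !eqxx ?orbT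
  | by apply: (two b c) => //; rewrite subUset !sub1set !inE !eqxx ?orbT].
Qed.

Section Star.

Variable x : T.
Hypothesis star_x : forall P : {set T}, #|P| = 2 -> meets_all H P -> x \in P.

Let L := [set l | (l != x) && meets_all H [set x; l]].

Let xL : x \notin L. Proof. by rewrite inE eqxx. Qed.

Let edge_without e : e \in H -> x \notin e -> L \subset e.
Proof.
move=> He xe; apply/subsetP=> l; rewrite inE => /andP[_ /meets_allP/(_ e He)[v]].
by rewrite !inE => /orP[]/eqP-> //; rewrite (negPf xe).
Qed.

Lemma card_leaves_leq : #|L| <= r.
Proof.
have [e He xe] := not_transversal1 x.
by rewrite -(Hr He) subset_leq_card ?edge_without.
Qed.

(** An edge containing a two-element transversal contains some [{x, l}] with [l] a leaf. Any other
    edge, being itself a transversal, is reached by three guesses inside edges of size [r]. *)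
Lemma card_H_few_leaves :
  #|H| <= #|L| * 'C(#|T|, r - 2) + r ^ 3 * 'C(#|T|, r - 3).
Proof.
pose P := [set [set x; l] | l in L].
pose F := [set e in H | [exists p in P, p \subset e]].
have leF : #|F| <= #|P| * 'C(#|T|, r - 2).
  apply: card_family_cover.
  - by move=> e; rewrite inE => /andP[/Hr].
  - by move=> _ /imsetP[l Ll ->]; rewrite cards2; case: eqP Ll xL => // -> ->.
  - by move=> e; rewrite inE => /andP[_ /exists_inP].
have leP : #|P| <= #|L| by apply: leq_imset_card.
have leF' : #|H :\: F| <= r ^ 3 * 'C(#|T|, r - (#|@set0 T| + 3)).
  apply: (@card_family_branch _ H); first by move=> e /Hr->.
    move=> e; rewrite inE => /andP[_ He]; split; rewrite ?sub0set ?Hr //.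
    by apply/forall_inP=> f; apply: Hi.
  move=> e U; rewrite !inE cards0 => /andP[nF He] Ue lt_U3; apply/negP=> HU.
  have U2 : #|U| = 2 by have := tauH HU; lia.
  have xU := star_x U2 HU; case/negP: nF; rewrite He; apply/exists_inP.
  exists U => //; have /card_gt0P[l] : 0 < #|U :\ x|.
    by have := cardsD1 x U; rewrite xU U2; lia.
  rewrite !inE => /andP[lx Ul]; have defU : U = [set x; l].
    by apply: set2_eq; rewrite // eq_sym.
  by apply/imsetP; exists l; rewrite // inE lx -defU.
rewrite cards0 in leF'; rewrite -(cardsID F H); apply: leq_add leF'.
have -> : H :&: F = F by apply/setIidPr/subsetP=> e; rewrite inE => /andP[].
by apply: leq_trans leF _; rewrite leq_mul2r leP orbT.
Qed.

Lemma many_leaves : r.-1 <= #|L| -> sub_some_HM r H.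
Proof.
move=> le_rL; left; have le_Lr := card_leaves_leq.
have [cL | cL] : #|L| = r \/ #|L| = r.-1 by lia.
  (* With [r] leaves, [L] is the only edge avoiding [x]; any [y] in [L] can play the vertex y_1 of
     HM(n,r,1). *)
  have /card_gt0P[y Ly] : 0 < #|L| by lia.
  have cX : #|L :\ y| = r.-1 by have := cardsD1 y L; rewrite Ly cL; lia.
  exists 1; split; first by lia.
  apply: (@sub_HM_of_sets _ _ _ _ x (L :\ y) [set y]) => //.
  - by rewrite cards1.
  - by rewrite inE (negPf xL) andbF.
  - by rewrite inE; apply: contraNneq xL => ->.
  - by rewrite disjoint_sym disjoints1 !inE eqxx.
  move=> e He; have [xe|xe] := boolP (x \in e); last first.
    constructor 2; exists y; rewrite ?set11 // setD1K //; apply/esym/eqP.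
    by rewrite eqEcard edge_without // Hr // cL leqnn.
  have [dis|] := boolP [disjoint e & L :\ y]; last by constructor 1.
  constructor 3; split; first by lia.
  rewrite subUset !sub1set xe /=; have [f Hf xf] := not_transversal1 x.
  have defL : L = f by apply/eqP; rewrite eqEcard edge_without // Hr // cL leqnn.
  have /set0Pn[z] := Hi He Hf; rewrite -defL inE => /andP[ez Lz].
  have := disjointFr dis ez; rewrite inE Lz andbT in_set1.
  by move/negbFE/eqP <-.
(* With [r - 1] leaves, the edges avoiding [x] are the sets [y |: L] with [y] in [Y], and an edge
   through [x] missing [L] must contain [Y]. *)
pose Y := [set y | (y \notin x |: L) && (y |: L \in H)].
have HY e : e \in H -> x \notin e -> exists2 y, y \in Y & e = y |: L.
  move=> He xe; have sLe := edge_without He xe.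
  have /card_gt0P[y] : 0 < #|e :\: L|.
    by rewrite cardsD (setIidPr sLe) Hr // cL; lia.
  rewrite inE => /andP[yL ye]; have defe : e = y |: L.
    apply/esym/eqP; rewrite eqEcard subUset sub1set ye sLe cardsU1 yL cL Hr //.
    by lia.
  exists y; rewrite // inE -defe He andbT in_setU1 negb_or yL andbT.
  by apply: contraNneq xe => <-.
have xY : x \notin Y by rewrite inE setU11.
have YH y : y \in Y -> [/\ y \notin L, y != x & y |: L \in H].
  by rewrite inE in_setU1 negb_or => /andP[/andP[]].
have [small | large] := leqP #|Y| r.-1.
  have Y_gt0 : 0 < #|Y|.
    have [e He xe] := not_transversal1 x; have [y Yy _] := HY e He xe.
    by apply/card_gt0P; exists y.
  exists #|Y|; split; first by rewrite Y_gt0 small.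
  apply: (@sub_HM_of_sets _ _ _ _ x L Y) => //.
    rewrite disjoint_sym disjoints_subset; apply/subsetP=> y /YH[yL _ _].
    by rewrite inE.
  move=> e He; have [xe|xe] := boolP (x \in e); last by constructor 2; apply: HY.
  have [dis|] := boolP [disjoint e & L]; last by constructor 1.
  constructor 3; split; first by rewrite Y_gt0.
  rewrite subUset sub1set xe; apply/subsetP=> y /YH[_ _ Hy].
  have /set0Pn[z] := Hi He Hy; rewrite in_setI in_setU1 => /andP[ez].
  by rewrite (disjointFr dis ez) orbF => /eqP <-.
(* Now [x |: Y] has more than [r] elements, so no edge through [x] misses [L], and every vertex
   outside [x |: L] may serve as some y_j. *)
exists (#|T| - r); split; first by rewrite eqxx orbT.
apply: (@sub_HM_of_sets _ _ _ _ x L (~: (x |: L))) => //.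
- have := cardsC (x |: L); rewrite cardsU1 xL cL; lia.
- by rewrite in_setC setU11.
- by rewrite disjoint_sym disjoints_subset setCS subsetUr.
move=> e He; have [xe|xe] := boolP (x \in e); last first.
  by constructor 2; have [y] := HY e He xe; rewrite inE => /andP[? _];
     exists y; rewrite // inE.
have [dis|] := boolP [disjoint e & L]; last by constructor 1.
have: x |: Y \subset e.
  rewrite subUset sub1set xe; apply/subsetP=> y /YH[_ _ Hy].
  have /set0Pn[z] := Hi He Hy; rewrite in_setI in_setU1 => /andP[ez].
  by rewrite (disjointFr dis ez) orbF => /eqP <-.
by move/subset_leq_card; rewrite cardsU1 xY (Hr He); lia.
Qed.

(** The second hypothesis excludes only the case [r = 4] with [L] a transversal, where [x] and [L]
    form a triangle. *)
Lemma leaves_r_minus_2 :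
    #|L| = r - 2 -> ~~ meets_all H L \/ 4 < r ->
  (exists2 K, is_HM'' r K & H \subset K) \/
  #|H| <= #|star_meeting r x L| + (3 * 'C(#|T|, r - 3) + 12 * 'C(#|T|, r - 4)).
Proof.
move=> cL nHL.
pose A := [set e in H | (x \in e) && [disjoint e & L]].
pose B := [set e in H | x \notin e].
have sH : H \subset star_meeting r x L :|: (A :|: B).
  apply/subsetP=> e He; rewrite !in_setU [e \in A]in_set [e \in B]in_set He.
  by rewrite inE Hr // eqxx; case: (x \in e); case: [disjoint e & L].
have BL e : e \in B -> L \subset e.
  by rewrite inE => /andP[]; apply: edge_without.
pose G := [set e :\: L | e in B].
have cG : #|G| = #|B|.
  apply: card_in_imset => e f /BL Le /BL Lf eqD.
  by rewrite -(setID e L) -(setID f L) eqD !(setIidPr _).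
pose A' := [set e :\ x | e in A].
have cA : #|A'| = #|A|.
  apply: card_in_imset => e f; rewrite !inE => /and3P[_ xe _] /and3P[_ xf _] eqD.
  by rewrite -(setD1K xe) eqD setD1K.
have G2 g : g \in G -> #|g| = 2.
  case/imsetP=> e Be ->; rewrite cardsD (setIidPr (BL e Be)) cL.
  by move: Be; rewrite inE => /andP[/Hr-> _]; lia.
have GB S : meets_all G S -> meets_all B (S :\: (x |: L)).
  move/meets_allP=> GS; apply/meets_allP=> e Be.
  have [v Sv] := GS _ (imset_f _ Be); rewrite inE => /andP[vL ev]; exists v => //.
  rewrite in_setD in_setU1 negb_or vL Sv !andbT; apply: contraTneq ev => ->.
  by move: Be; rewrite inE => /andP[].
(* A single vertex [v] covering [G] would make [{x, v}] a transversal, hence [v] a leaf, although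
   leaves were removed from the edges of [G]. *)
have tauG S : meets_all G S -> 2 <= #|S|.
  move/GB=> BS; rewrite ltnNge; apply/negP=> le_S1.
  have Hx : meets_all H (x |: (S :\: (x |: L))).
    apply/meets_allP=> e He; have [xe|xe] := boolP (x \in e).
      by exists x; rewrite ?setU11.
    have /meets_allP/(_ e)[|v Sv ev] := BS; first by rewrite inE He.
    by exists v; rewrite // in_setU1 Sv orbT.
  have := tauH Hx; rewrite cardsU1 => c2.
  have : 0 < #|S :\: (x |: L)| by lia.
  case/card_gt0P=> v Sv; have /set1P defS : S \in [set [set v]].
    by rewrite inE eq_sym eqEcard cards1 le_S1 sub1set; move: Sv;
       rewrite inE => /andP[_ ->].
  move: Sv Hx; rewrite defS; rewrite !inE negb_or => /andP[/andP[vx vL] _] Hx.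
  move: vL; rewrite vx /= => /negP; apply; apply: meets_allS Hx.
  apply/subsetP=> w; rewrite !inE => /orP[->//|/andP[_ ->]]; exact: orbT.
have A'props e : e \in A' -> #|e| = (r - 3).+2 /\ meets_all G e.
  case/imsetP=> f; rewrite inE => /and3P[Hf xf dL] ->; split.
    by have := cardsD1 x f; rewrite xf Hr //; lia.
  apply/meets_allP=> _ /imsetP[b + ->]; rewrite inE => /andP[Hb xb].
  have /set0Pn[z] := Hi Hf Hb; rewrite inE => /andP[fz bz].
  exists z; rewrite ?in_setD1 ?in_setD ?fz ?bz ?(disjointFr dL fz) ?andbT //.
  by apply: contraNneq xb => <-.
(* For [r = 4], an edge missed by [L] must contain [x], as edges avoiding [x] contain [L]; so it
   lies in [A]. *)
have k1A : 1 < r - 3 \/ A' != set0.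
  case: nHL => [/not_meets_allP[e He Le] | ?]; [right | left; lia].
  apply/set0Pn; exists (e :\ x); apply: imset_f; rewrite inE He /=.
  have dL : [disjoint e & L].
    by rewrite disjoint_sym disjoints_subset; apply/subsetP=> v /Le; rewrite inE.
  rewrite dL andbT; apply/negPn/negP=> /(edge_without He) sLe.
  have /card_gt0P[l Ll] : 0 < #|L| by lia.
  by have := Le l Ll; rewrite (subsetP sLe).
have [||[g1 [g2 [d12 c1 c2 defG]]]|leAG] := card_graph_and_covers G2 tauG _ _ A'props k1A.
- by lia.
- by lia.
- left; have /eqP/cards2P[y1 [y1' [n1 def1]]] := c1.
  have /eqP/cards2P[y2 [y2' [n2 def2]]] := c2.
  have Gv g z : g \in G -> z \in g -> (z != x) && (z \notin L).
    case/imsetP=> e; rewrite inE => /andP[He xe] ->; rewrite inE => /andP[-> ez].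
    by rewrite andbT; apply: contraNneq xe => <-.
  have V : HM''_vertices r x L y1 y1' y2 y2'.
    have sub z : z \in [:: y1; y1'; y2; y2'] -> (z != x) && (z \notin L).
      rewrite (mem_cat z [:: y1; y1'] [:: y2; y2']) !mem_seq2 => /orP[]zg.
        by apply: (Gv g1); rewrite ?defG ?def1 !inE ?eqxx.
      by apply: (Gv g2); rewrite ?defG ?def2 !inE ?eqxx ?orbT.
    split; first by rewrite cL; lia.
      rewrite cons_uniq; apply/andP; split.
        by apply/negP=> /sub; rewrite eqxx.
      rewrite (cat_uniq [:: y1; y1'] [:: y2; y2']) /= !inE n1 n2 !andbT /= orbF.
      rewrite -!(in_set2) -def1 negb_or.
      by rewrite !(disjointFl d12) // def2 !inE eqxx ?orbT.
    by move=> z /predU1P[->//|/sub/andP[]].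
  exists (HM''_set r x L y1 y1' y2 y2').
    by apply/is_HM''P; exists x, L, y1, y1', y2, y2'.
  apply/subsetP=> e He; rewrite inE Hr // eqxx /=.
  have [xe|xe] := boolP (x \in e); last first.
    have Be : e \in B by rewrite inE He.
    have defe : e = L :|: (e :\: L).
      by rewrite -[LHS](setID e L) (setIidPr (BL e Be)).
    have : e :\: L \in G by apply: imset_f.
    rewrite defG => /set2P[]; rewrite ?def1 ?def2 => eD.
      by rewrite defe eD eqxx.
    by rewrite defe eD eqxx !orbT.
  have [dis|//] := boolP [disjoint e & L].
  have /A'props[_ /meets_allP Ge] : e :\ x \in A'.
    by apply: imset_f; rewrite inE He xe dis.
  have [|u] := Ge g1; first by rewrite defG !inE eqxx.
  have [|v] := Ge g2; first by rewrite defG !inE eqxx orbT.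
  rewrite !inE => /andP[_ ev] + /andP[_ eu]; rewrite def1 def2 !inE.
  by move=> /orP[]/eqP eqv /orP[]/eqP equ; rewrite -?equ -?eqv ?eu ?ev ?orbT.
right; apply: leq_trans (subset_leq_card sH) _.
apply: leq_trans (leq_card_setU _ _) _; rewrite leq_add2l.
apply: leq_trans (leq_card_setU _ _) _; rewrite -cA -cG.
by have -> : r - 4 = (r - 3).-1 by lia.
Qed.

End Star.
End Structure.

(** * Comparison with HM''(n,r) and conclusion *)

Lemma sub_some_HMS r (T : finType) (H K : {set {set T}}) :
  H \subset K -> sub_some_HM r K -> sub_some_HM r H.
Proof.
move=> sHK [[t [tr [x [xs [ys [U sub]]]]]] | [r4 [a [b [c [U sub]]]]]].
  by left; exists t; split=> //; exists x, xs, ys; split; last exact: subset_trans sub.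
by right; split=> //; exists a, b, c; split; last exact: subset_trans sub.
Qed.

Lemma vertices_HM'' r (T : finType) x (L : {set T}) y1 y1' y2 y2' :
  HM''_vertices r x L y1 y1' y2 y2' -> is_HM'' r (HM''_set r x L y1 y1' y2 y2').
Proof. by move=> V; apply/is_HM''P; exists x, L, y1, y1', y2, y2'. Qed.

Lemma maximal_sub_some_HM r (T : finType) (H : {set {set T}}) :
    4 <= r -> r + r + 5 <= #|T| ->
    large_enough r #|T| ->
    maximal_intersecting r H ->
    (forall S : {set T}, meets_all H S -> 2 <= #|S|) ->
    hm'' #|T| r < #|H| ->
  sub_some_HM r H.
Proof.
move=> r_ge4 le_rT large Hmax tauH; rewrite ltnNge => big.
have le_rrT : r + r <= #|T| by lia.
have r_gt1 : 1 < r by lia.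
have le_r3T : r + 3 <= #|T| by lia.
have triangle a b c : uniq [:: a; b; c] -> meets_all H [set a; b] ->
    meets_all H [set a; c] -> meets_all H [set b; c] -> sub_some_HM r H.
  move=> U ab ac bc; have sH := triangle_sub_HM0 Hmax U ab ac bc.
  have [r4 | r_gt4] : r = 4 \/ 4 < r by lia.
    by right; split=> //; exists a, b, c; rewrite r4 in sH.
  case/negP: big; move: (U); rewrite /= !inE negb_or.
  case/and3P=> /andP[nab nac] nbc _.
  (* The copy of HM''(n,r) is chosen with centre [a] and with [b], [c] in [L], so that its star
     contains the edges of HM(n,r,0) through [a]. *)
  have [|||L [sL cL dL]] := @exists_superset_avoiding _ [set b; c] [set a] (r - 2).
  - by rewrite disjoint_sym disjoints1 !inE negb_or nab.
  - by rewrite cards2 nbc; lia.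
  - by rewrite cards1; lia.
  have aL : a \notin L by rewrite -disjoints1 disjoint_sym.
  have [||y1 [y1' [y2 [y2' V]]]] := @HM''_vertices_exist r T a L _ aL.
  - by rewrite cL subn2.
  - by rewrite cL; clear -le_rT r_ge4; lia.
  move: sL; rewrite subUset !sub1set => /andP[Lb Lc].
  rewrite (hm''_eq r_gt1 le_r3T (vertices_HM'' V)).
  apply: leq_trans (card_HM''_ge_star r_ge4 V).
  apply: leq_trans (subset_leq_card sH) _.
  apply: leq_trans (card_HM0_leq r_gt4 U aL Lb Lc _) _.
    by rewrite cL; clear -r_gt4; lia.
  by rewrite leq_add2l; case: large => _; apply: leq_trans; rewrite mulSn -addnA leq_addr.
have [[a [b [c [U ab ac bc]]]] | [x star_x]] := triangle_or_star r_ge4 le_rrT Hmax.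
  exact: triangle U ab ac bc.
pose L := [set l | (l != x) && meets_all H [set x; l]].
have xL : x \notin L by rewrite inE eqxx.
have [many | few] := leqP r.-1 #|L|.
  exact: (@many_leaves r T H r_ge4 le_rrT Hmax tauH x many).
have [cL | le_L3] : #|L| = r - 2 \/ #|L| <= r - 3 by lia.
  have [HL | nHL] : (meets_all H L /\ r = 4) \/ (~~ meets_all H L \/ 4 < r).
    case: (meets_all H L); last by right; left.
    by case: (ltnP 4 r); [right; right | left; lia].
    have [HL4 r4] := HL; have /eqP/cards2P[b [c [bc defL]]] : #|L| = 2 by lia.
    have Lb : b \in L by rewrite defL !inE eqxx.
    have Lc : c \in L by rewrite defL !inE eqxx orbT.
    rewrite defL in HL4; move: Lb Lc.
    rewrite !inE => /andP[bx Hb] /andP[cx Hc]; apply: (triangle x b c) => //.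
    by rewrite /= !inE negb_or bc (eq_sym x) bx eq_sym cx.
  have [||y1 [y1' [y2 [y2' V]]]] := @HM''_vertices_exist r T x L _ xL; try lia.
  case/negP: big; rewrite (hm''_eq r_gt1 le_r3T (vertices_HM'' V)).
  have [[K HK sHK] | leH] := leaves_r_minus_2 r_ge4 le_rrT Hmax tauH cL nHL.
    apply: leq_trans (subset_leq_card sHK) _.
    exact: leq_card_HM'' (erefl _) HK (vertices_HM'' V).
  apply: leq_trans leH _; apply: leq_trans (card_HM''_ge_star r_ge4 V).
  by rewrite leq_add2l; case: large.
case/negP: big; have [K HK] := is_HM''_exists r_gt1 le_r3T.
rewrite (hm''_eq r_gt1 le_r3T HK).
have [u [M [y1 [y1' [y2 [y2' [V ->]]]]]]] := (is_HM''P r K).1 HK.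
apply: leq_trans (card_HM''_ge_bin r_ge4 V); apply: leq_trans large.1.
apply: leq_trans (card_H_few_leaves r_ge4 le_rrT Hmax tauH star_x) _.
by rewrite leq_add2r leq_mul2r le_L3 orbT.
Qed.

Theorem theorem6 (r : nat) (hr : 4 <= r) :
  exists n0 : nat, forall n : nat, n0 <= n ->
  forall T : finType, #|T| = n ->
    (forall H : {set {set T}},
       r_graph r H -> intersecting H -> 2 <= tau H -> hm'' n r < #|H| ->
       sub_some_HM r H)
    /\
    ((exists K : {set {set T}}, is_HM'' r K) /\
     (forall K : {set {set T}}, is_HM'' r K ->
        [/\ r_graph r K, intersecting K, 2 <= tau K, #|K| = hm'' n r
          & ~ sub_some_HM r K])).
Proof.
have [N large] := large_enough_eventually hr.
(* [N] secures the binomial inequalities; [r + r + 5] leaves room for the special vertices and for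
   [r]-sets avoiding small sets. *)
exists (N + (r + r + 5)) => n le_n T cT; rewrite -cT in le_n *.
have {}large : large_enough r #|T| by apply: large; lia.
have r_gt0 : 0 < r by lia.
split=> [H Hr Hi tauH big|].
  (* Passing to [K] keeps the hypotheses: transversals of [K] are transversals of [H], and [K] has
     at least as many edges. *)
  have [K Kmax sHK] := maximal_intersecting_exists r_gt0 Hr Hi.
  apply: (sub_some_HMS sHK); apply: (maximal_sub_some_HM hr _ large Kmax).
  - by lia.
  - move=> S KS; apply: ((tau_gtP _ (meets_all_setT r_gt0 Hr)).1 tauH).
    by apply/forall_inP=> e /(subsetP sHK) He; apply: (forall_inP KS).
  - exact: leq_trans big (subset_leq_card sHK).
split; first by apply: is_HM''_exists; lia.
move=> K HK; rewrite (hm''_eq _ _ HK); try lia.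
have [x [L [y1 [y1' [y2 [y2' [V ->]]]]]]] := (is_HM''P r K).1 HK.
split=> //.
- exact: HM''_r_graph.
- exact: HM''_intersecting hr V.
- by apply: HM''_tau hr V _; lia.
- by apply: HM''_not_sub_some_HM hr V _; lia.
Qed.
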